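(* Let $W$ be a Coxeter group with simple generators $S$ and let $\Omega$ be an orientation of its Coxeter diagram $\Gamma$. If $A$ is a nonempty set of $\Omega$-sortable elements of $W$, then $\bigwedge A$ is $\Omega$-sortable. If $A$ is a set of $\Omega$-sortable elements of $W$ such that $\bigvee A$ exists, then $\bigvee A$ is $\Omega$-sortable.
   Context: $W$ is a Coxeter group with finite set $S$ of simple generators; $\ell$ is the length function and $e$ the identity. The (right) weak order on $W$ sets $u\le w$ if and only if $\ell(u)+\ell(u^{-1}w)=\ell(w)$. Meets $\bigwedge$ and joins $\bigvee$ are taken in the weak order on $W$; every nonempty subset of $W$ has a meet, and a subset with an upper bound has a join. The Coxeter diagram $\Gamma$ is the graph with vertex set $S$ in which distinct $s,t$ are joined by an edge if and only if they do not commute. $\Omega$ is an arbitrary orientation of $\Gamma$ (each edge is given one direction; directed cycles are allowed). A subset $J\subseteq S$ is $\Omega$-acyclic if the induced subgraph of $\Gamma$ on $J$, oriented by $\Omega$, has no directed cycle. For $\Omega$-acyclic $J$, $c(\Omega,J)=s_1s_2\cdots s_k$, where $s_1,\ldots,s_k$ is any ordering of $J$ such that $i<j$ whenever there is an edge oriented $s_j\to s_i$ (the product does not depend on the ordering; $c(\Omega,\emptyset)=e$). $J(w,\Omega)$ denotes the unique maximal (under inclusion) element among the $\Omega$-acyclic subsets $J'\subseteq S$ with $w\ge c(\Omega,J')$ (it is a fact that there is a unique maximal one, which therefore contains all the others). $\Omega$-sortable elements: given $w\in W$, set $w_1=w$ and, inductively, $J_i=J(w_i,\Omega)$, $w_{i+1}=c(\Omega,J_i)^{-1}w_i$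 (so $J_i=\emptyset$ for $i$ large). The element $w$ is $\Omega$-sortable if $J_1\supseteq J_2\supseteq J_3\supseteq\cdots$. *)

(* Defs.v *)
From HB Require Import structures.
From mathcomp Require Import all_boot.

Set Implicit Arguments.
Unset Strict Implicit.
Unset Printing Implicit Defensive.

Local Open Scope group_scope.

(* An entry [0] of the matrix stands for infinity. *)
Definition coxeter_matrix (S : finType) (m : S -> S -> nat) : Prop :=
  [/\ forall s, m s s = 1%N,
      forall s t, m s t = m t s
    & forall s t, s != t -> m s t != 1%N].

(* The congruence on words generated by the relations (s t)^(m s t) = 1.  Since
   m s s = 1 makes each generator its own inverse, the quotient of the free
   monoid on S by this congruence is the group presented by these relations;
   when m s t = 0 the relation is trivial. *)
Inductive word_equiv (S : finType) (m : S -> S -> nat) : seq S -> seq S -> Prop :=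
| WordRel p q s t :
    word_equiv m (p ++ flatten (nseq (m s t) [:: s; t]) ++ q) (p ++ q)
| WordRefl u : word_equiv m u u
| WordSym u v : word_equiv m u v -> word_equiv m v u
| WordTrans u v w : word_equiv m u v -> word_equiv m v w -> word_equiv m u w.

Definition word_prod (W : groupType) (S : finType) (g : S -> W) (u : seq S) : W :=
  \prod_(s <- u) g s.

(* [W] is the group presented by [simple_refl] and [cox_m], through [gen]. *)
Record coxeterSystem (W : groupType) := CoxeterSystem {
  simple_refl : finType;
  gen : simple_refl -> W;
  cox_m : simple_refl -> simple_refl -> nat;
  cox_mP : coxeter_matrix cox_m;
  gen_surj : forall w : W, exists u : seq simple_refl, word_prod gen u = w;
  gen_rel : forall u v : seq simple_refl,
    word_prod gen u = word_prod gen v <-> word_equiv cox_m u v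
}.

Section Sortable.

Variables (W : groupType) (C : coxeterSystem W).
Local Notation S := (simple_refl C).

Lemma cox_length_subproof (w : W) :
  exists k, [exists u : k.-tuple S, word_prod (@gen W C) u == w].
Proof.
have [u <-] := gen_surj C w.
by exists (size u); apply/existsP; exists (in_tuple u); apply/eqP.
Qed.

Definition cox_length (w : W) : nat := ex_minn (cox_length_subproof w).

(* The right weak order. *)
Definition weak_le (u w : W) : bool :=
  (cox_length u + cox_length (u^-1 * w) == cox_length w)%N.

Definition is_meet (A : W -> Prop) (m : W) : Prop :=
  (forall a, A a -> weak_le m a) /\
  (forall x, (forall a, A a -> weak_le x a) -> weak_le x m).

Definition is_join (A : W -> Prop) (j : W) : Prop :=
  (forall a, A a -> weak_le a j) /\
  (forall x, (forall a, A a -> weak_le a x) -> weak_le j x).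

Definition diagram_edge : rel S :=
  fun s t => (s != t) && (gen s * gen t != gen t * gen s).

(* [Om s t] means that the edge between [s] and [t] is directed s -> t. *)
Definition orientation (Om : rel S) : Prop :=
  (forall s t, Om s t -> diagram_edge s t) /\
  (forall s t, diagram_edge s t -> Om s t (+) Om t s).

Variable Om : rel S.

(* A cycle has distinct vertices, hence some length k.+1 with k < #|S|. *)
Definition acyclic (J : {set S}) : bool :=
  ~~ [exists k : 'I_#|S|, exists p : k.+1.-tuple S,
        ucycleb Om p && all [in J] p].

(* The ordering s_1, ..., s_k has i < j for each edge s_j -> s_i. *)
Definition compatible (u : seq S) : bool :=
  all2rel (fun s t => Om t s ==> (index s u < index t u)%N) u.

(* The product does not depend on the ordering when J is acyclic; junk value
   otherwise. *)
Definition cox_elt (J : {set S}) : W :=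
  word_prod (@gen W C) (head [::] [seq u <- permutations (enum J) | compatible u]).

Definition acyclic_below (w : W) (J : {set S}) : bool :=
  acyclic J && weak_le (cox_elt J) w.

(* The maximal acyclic J with c(Om, J) <= w; it is unique when Om is an
   orientation, and the default is never used since the empty set qualifies. *)
Definition maxJ (w : W) : {set S} :=
  odflt set0 [pick J : {set S} | maxset (acyclic_below w) J].

Definition sort_step (w : W) : W := (cox_elt (maxJ w))^-1 * w.

(* With w_(i+1) := iter i sort_step w, the sets J_(i+1) = maxJ w_(i+1) form a
   weakly decreasing sequence. *)
Definition sortable (w : W) : Prop :=
  forall i, maxJ (iter i.+1 sort_step w) \subset maxJ (iter i sort_step w).

End Sortable.

(* Main.v *)
(* Let W act on its geometric representation and order W by inclusion of the sets
   of inversions, i.e. of positive roots made negative by the inverse. An element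
   is called aligned when, for positive roots b1, b2 with omega(b1, b2) > 0 and
   every inversion c in the open cone of b1 and b2, also b1 is an inversion;
   here omega is the skew form attached to the orientation. For an acyclic set J
   with sink s, an aligned element of W_J is either above s, and then s w is
   aligned for the orientation reversed at s, or lies in W_(J - s). Reading the
   letters of J one after the other, it follows that w is sortable iff it is
   aligned and lies in W_J for some acyclic J.

   Alignment passes to parabolic components, so induction on length and rank
   shows that meets of aligned elements are aligned. For joins the critical case
   is j = s \/ a with s a sink and a in W_(J - s): choosing a sink t of J - s
   below a, j is also the join of s \/ t and a, both above t, so by induction j is
   aligned for the orientation reversed at s; there e_s is never a subobject
   b1, hence s j, whose inversions are those of j except e_s, is aligned too.

   Cycles are excluded as follows: if c(I) and c(K) lie below w and I + K has a
   directed cycle, then w has two inversions b, c with bil b c <= -2. The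
   reflections in b and c generate an infinite dihedral group, which would give
   w infinitely many inversions. *)

From HB Require Import structures.
From Stdlib Require Import Reals Classical.
Require Import Defs.
From mathcomp Require Import all_boot all_order all_algebra.
From mathcomp Require Import Rstruct ring lra zify.

Set Implicit Arguments.
Unset Strict Implicit.
Unset Printing Implicit Defensive.

Import Order.TTheory GRing.Theory Num.Theory.
Local Open Scope ring_scope.

(** * Coefficients of the bilinear form *)

(** The inductions on aligned elements consume sinks, so they run inside a single acyclic J, whereas
    the elements of A come with different sets J(a) and Omega may have cycles. For a join j, c(J(a))
    <= a <= j puts every J(a) inside J(j); this is what the closure under union of the sets I with
    c(I) <= w is for. For a meet a single a suffices: the meet lies in W_{J(a)}, and it is also the
    meet of the W_{J(a)}-components of all elements of A.

    Alignment is a condition on inversions alone, and omega is invariant under the reflection at a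
    sink if the orientation is reversed there; this lets s be cancelled. The intermediate joins are
    replaced by minimal upper bounds: these exist below every upper bound, by induction on length,
    and they survive both restriction to W_J and cancellation of a common left descent.

    The bound -2 in the exclusion of cycles arises because an edge has coefficient at least 2 cos
    (PI / 3) = 1: two distinct edges between roots with disjoint supports, with coordinates at least
    1 at their ends, already give -2. *)

Definition cfield : realFieldType := Rdefinitions.R.
Notation F := cfield.

(* Minus twice the entry of Tits' bilinear form; m = 0 stands for infinity. *)
Definition cox_coef (m : nat) : F :=
  if m is 0 then 2 else 2 * cos (PI / m%:R)%R.

(** Chebyshev polynomials of the second kind: for [a = 2 cos t] the value is sin (k t) / sin t. They
    are the coordinates of the roots of a dihedral group in its two simple roots. *)
Fixpoint cheb (a : F) (k : nat) : F :=
  match k with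
  | 0 => 0
  | k'.+1 => if k' is k''.+1 then a * cheb a k' - cheb a k'' else 1
  end.

Arguments cheb : simpl never.

Lemma cheb0 a : cheb a 0 = 0. Proof. by []. Qed.
Lemma cheb1 a : cheb a 1 = 1. Proof. by []. Qed.
Lemma chebSS a k : cheb a k.+2 = a * cheb a k.+1 - cheb a k.
Proof. by []. Qed.

(** The form x^2 - a x y + y^2 is constant along the recurrence: the roots of a dihedral group all
    have the same norm. *)
Lemma cheb_norm a k :
  cheb a k.+1 ^+ 2 = 1 + a * cheb a k * cheb a k.+1 - cheb a k ^+ 2.
Proof.
elim: k => [|k IH]; first by rewrite cheb0 cheb1; ring.
rewrite chebSS; move: IH; set x := cheb a k.+1; set y := cheb a k => IH; lra.
Qed.

Lemma cheb_grow a k : 2 <= a -> cheb a k + 1 <= cheb a k.+1 /\ 0 <= cheb a k.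
Proof.
move=> a2; elim: k => [|k [IH1 IH2]]; first by rewrite cheb0 cheb1; split; lra.
rewrite chebSS; split; last lra.
have := ler_wpM2r (x := cheb a k.+1) _ a2; move=> /(_ ltac:(lra)); lra.
Qed.

Lemma cheb_ge_index a k : 2 <= a -> k%:R <= cheb a k.
Proof.
move=> a2; elim: k => [|k IH]; first by [].
have [+ _] := cheb_grow k a2; rewrite -[k.+1]addn1 natrD addn1; lra.
Qed.

Lemma cheb_sin (t : F) k : cheb (2 * cos t) k * sin t = sin (k%:R * t)%R.
Proof.
elim/ltn_ind: k => -[|[|k]] IH.
- by rewrite cheb0 mulr0n !mul0r; apply: esym; exact: sin_0.
- by rewrite cheb1 !mul1r.
rewrite chebSS mulrBl -mulrA IH // IH //.
have -> : k.+2%:R * t = k.+1%:R * t + t by rewrite -[k.+2]addn1 natrD mulrDl mul1r.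
have -> : k%:R * t = k.+1%:R * t - t by rewrite -[k.+1]addn1 natrD mulrDl mul1r addrK.
set x := k.+1%:R * t.
have -> : sin (x + t)%R = sin x * cos t + cos x * sin t := sin_plus x t.
have -> : sin (x - t)%R = sin x * cos t - cos x * sin t := sin_minus x t.
ring.
Qed.

Lemma PI_gt0 : 0 < PI :> F.
Proof. exact/RltP/PI_RGT_0. Qed.

Lemma PI_div_gt0 m : 0 < (PI / m.+1%:R)%R :> F.
Proof. by rewrite divr_gt0 ?PI_gt0 // ltr0n. Qed.

Lemma PI_div_lt m k : (k < m.+1)%N -> k%:R * (PI / m.+1%:R) < PI :> F.
Proof.
move=> km; rewrite mulrCA -[ltRHS]mulr1 ltr_pM2l ?PI_gt0 //.
by rewrite ltr_pdivrMr ?ltr0n // mul1r ltr_nat.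
Qed.

Lemma PI_div_lt1 m : (0 < m)%N -> (PI / m.+1%:R)%R < PI :> F.
Proof. by move=> m0; have := @PI_div_lt m 1; rewrite mul1r; apply. Qed.

(** For m > 1 the sign is that of sin (k PI / m). For the code 0 of infinity, [a = 2] and the values
    are at least k. *)
Lemma cheb_gt0 m k : m != 1%N -> (0 < k)%N -> (0 < m -> k < m)%N ->
  0 < cheb (cox_coef m) k.
Proof.
case: m => [_ k0 _|m m1 k0 /(_ isT) km].
  apply: (@lt_le_trans _ _ k%:R); first by rewrite ltr0n.
  by apply: cheb_ge_index; rewrite /cox_coef.
have s0 : (0:F) < sin (PI / m.+1%:R)%R.
  apply/RltP/sin_gt_0; apply/RltP; first exact: PI_div_gt0.
  by apply: PI_div_lt1; rewrite lt0n -eqSS.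
rewrite -(pmulr_lgt0 _ s0) /cox_coef cheb_sin.
apply/RltP/sin_gt_0; apply/RltP; last exact: PI_div_lt.
by rewrite mulr_gt0 ?PI_div_gt0 ?ltr0n.
Qed.

Lemma cheb_eq0 m : (1 < m)%N -> cheb (cox_coef m) m = 0.
Proof.
case: m => // m m1.
have s0 : (0:F) < sin (PI / m.+1%:R)%R.
  apply/RltP/sin_gt_0; apply/RltP; first exact: PI_div_gt0.
  exact: PI_div_lt1.
apply: (mulIf (lt0r_neq0 s0)); rewrite mul0r /cox_coef cheb_sin.
by rewrite mulrC divfK ?pnatr_eq0 // sin_PI.
Qed.

Lemma cox_coef1 : cox_coef 1 = - 2.
Proof. by rewrite /cox_coef divr1 (cos_PI : cos PI = (-1)%R); ring. Qed.

Lemma cox_coef2 : cox_coef 2 = 0.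
Proof. by rewrite /cox_coef -RdivE cos_PI2 mulr0. Qed.

(** For m >= 3, cos (PI / m) >= cos (PI / 3) = 1 / 2. Later estimates rest on the resulting gap:
    between distinct generators a coefficient is 0 or at least 1. *)
Lemma cox_coef_ge1 m : m != 1%N -> m != 2%N -> 1 <= cox_coef m.
Proof.
case: m => [|[|[|m]]] // _ _; first by rewrite /cox_coef ler1n.
have c3 : 1 / 2 = cos (PI / 3%:R)%R :> F.
  rewrite (_ : (PI / 3%:R)%R = Rdiv PI 3); last by rewrite RdivE; congr (_ / _); lra.
  by rewrite cos_PI3 RdivE.
have h : cos (PI / 3%:R)%R <= cos (PI / m.+3%:R)%R :> F.
  have i k : ((0 : F) <= PI / k.+2%:R <= PI)%R by rewrite !ltW ?PI_div_gt0 ?PI_div_lt1.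
  have /andP[a1 a2] := i m.+1; have /andP[b1 b2] := i 1%N.
  apply/RleP/cos_decr_1; apply/RleP => //.
  by rewrite ler_pM2l ?PI_gt0 // lef_pV2 ?posrE ?ltr0n // ler_nat.
rewrite /cox_coef; move: h; rewrite -c3; lra.
Qed.

(** * Coordinate vectors, positivity and supports *)

Definition vect (S : finType) := {ffun S -> F}.
HB.instance Definition _ S := GRing.Zmodule.on (vect S).

Section Vectors.

Variable S : finType.
Implicit Types (v w : vect S) (c : F).

Definition vscale c v : vect S := [ffun s => c * v s].

Fact vscaleA a b v : vscale a (vscale b v) = vscale (a * b) v.
Proof. by apply/ffunP => s; rewrite !ffunE mulrA. Qed.

Fact vscale1 : left_id 1 vscale.
Proof. by move=> v; apply/ffunP => s; rewrite !ffunE mul1r. Qed.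

Fact vscaleDr : right_distributive vscale +%R.
Proof. by move=> a u v; apply/ffunP => s; rewrite !ffunE mulrDr. Qed.

Fact vscaleDl v : {morph vscale^~ v : a b / a + b}.
Proof. by move=> a b; apply/ffunP => s; rewrite !ffunE mulrDl. Qed.

HB.instance Definition _ :=
  GRing.Zmodule_isLmodule.Build F (vect S) vscaleA vscale1 vscaleDr vscaleDl.

Lemma vZE c v s : (c *: v) s = c * v s. Proof. by rewrite ffunE. Qed.
Lemma vDE v w s : (v + w) s = v s + w s. Proof. by rewrite ffunE. Qed.
Lemma vNE v s : (- v) s = - v s. Proof. by rewrite ffunE. Qed.
Lemma v0E s : (0 : vect S) s = 0. Proof. by rewrite ffunE. Qed.
Definition vE := (vZE, vDE, vNE, v0E).

Definition basis s : vect S := [ffun t => (t == s)%:R].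

Lemma basisE s t : basis s t = (t == s)%:R. Proof. by rewrite ffunE. Qed.

Definition nonneg v := forall s, 0 <= v s.

Definition supported (J : {set S}) v := forall s, s \notin J -> v s = 0.

Lemma nonnegD v w : nonneg v -> nonneg w -> nonneg (v + w).
Proof. by move=> v0 w0 s; rewrite vDE addr_ge0. Qed.

Lemma nonnegZ c v : 0 <= c -> nonneg v -> nonneg (c *: v).
Proof. by move=> c0 v0 s; rewrite vZE mulr_ge0. Qed.

Lemma nonneg_basis s : nonneg (basis s).
Proof. by move=> t; rewrite basisE ler0n. Qed.

Lemma nonneg_anti v : nonneg v -> nonneg (- v) -> v = 0.
Proof.
move=> v0 vN; apply/ffunP => s; rewrite v0E; apply/le_anti.
by have := vN s; rewrite vNE oppr_ge0 => ->; rewrite v0.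
Qed.

Lemma supportedD J v w : supported J v -> supported J w -> supported J (v + w).
Proof. by move=> v0 w0 s sJ; rewrite vDE v0 // w0 // addr0. Qed.

Lemma supportedZ J c v : supported J v -> supported J (c *: v).
Proof. by move=> v0 s sJ; rewrite vZE v0 // mulr0. Qed.

Lemma supportedN J v : supported J v -> supported J (- v).
Proof. by move=> v0 s sJ; rewrite vNE v0 // oppr0. Qed.

Lemma supported_basis (J : {set S}) s : s \in J -> supported J (basis s).
Proof.
move=> sJ t; rewrite basisE; case: eqP => // -> /negP[]; exact: sJ.
Qed.

Lemma supportedW (J K : {set S}) v : J \subset K -> supported J v -> supported K v.
Proof. by move=> /subsetP JK v0 s sK; apply: v0; apply: contra sK => /JK. Qed.

Lemma supported_comb (J : {set S}) x y v w : 0 < x -> 0 < y -> nonneg v -> nonneg w ->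
  supported J (x *: v + y *: w) -> supported J v /\ supported J w.
Proof.
move=> x0 y0 v0 w0 vwJ.
have h s : s \notin J -> x * v s = 0 /\ y * w s = 0.
  move=> /vwJ/eqP; rewrite vDE !vZE paddr_eq0 ?mulr_ge0 ?(ltW x0) ?(ltW y0) ?v0 ?w0 //.
  by case/andP => /eqP-> /eqP->.
by split=> s /h [/eqP + /eqP]; rewrite !mulf_eq0 (gt_eqF x0) (gt_eqF y0) /= =>
  /eqP ? /eqP ?.
Qed.

End Vectors.

(** * The geometric representation *)

Section GeometricRepresentation.

Variables (W : groupType) (C : coxeterSystem W).
Local Notation S := (simple_refl C).
Local Notation V := (vect S).
Local Notation g := (@gen W C).
Local Notation e := (@basis S).
Local Notation len := (@cox_length W C).
Implicit Types (s t : S) (u v w : W) (p q : seq S) (x y : V).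

Definition coef s t : F := cox_coef (cox_m s t).

Lemma coefC s t : coef s t = coef t s.
Proof. by rewrite /coef; case: (cox_mP C) => _ -> _. Qed.

Lemma coefss s : coef s s = - 2.
Proof. by rewrite /coef; case: (cox_mP C) => -> _ _; exact: cox_coef1. Qed.

Lemma coef_ge s t : s != t -> coef s t = 0 \/ 1 <= coef s t.
Proof.
move=> st; have m1 : cox_m s t != 1%N by case: (cox_mP C) => _ _; apply.
rewrite /coef; have [->|m2] := eqVneq (cox_m s t) 2%N; first by left; exact: cox_coef2.
by right; apply: cox_coef_ge1.
Qed.

Lemma coef_ge0 s t : s != t -> 0 <= coef s t.
Proof. by case/coef_ge => [->|/(le_trans ler01)]. Qed.

Definition lam s x : F := \sum_t coef s t * x t.

Lemma lamD s x y : lam s (x + y) = lam s x + lam s y.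
Proof. by rewrite /lam -big_split; apply: eq_bigr => t _; rewrite vDE mulrDr. Qed.

Lemma lamZ s c x : lam s (c *: x) = c * lam s x.
Proof.
by rewrite /lam mulr_sumr; apply: eq_bigr => t _; rewrite vZE mulrCA.
Qed.

Lemma lam_basis s t : lam s (e t) = coef s t.
Proof.
rewrite /lam (bigD1 t) //= basisE eqxx mulr1 big1 ?addr0 // => i it.
by rewrite basisE (negPf it) mulr0.
Qed.

Definition bil x y : F := - \sum_s x s * lam s y.

Lemma bilDl x y z : bil (x + y) z = bil x z + bil y z.
Proof.
by rewrite /bil -opprD -big_split; congr (- _); apply: eq_bigr => s _; rewrite vE mulrDl.
Qed.

Lemma bilZl c x y : bil (c *: x) y = c * bil x y.
Proof.
by rewrite /bil mulrN mulr_sumr; congr (- _); apply: eq_bigr => s _; rewrite vE mulrA.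
Qed.

Lemma bilC x y : bil x y = bil y x.
Proof.
rewrite /bil; congr (- _); rewrite /lam.
under eq_bigr => s _ do rewrite mulr_sumr.
under [RHS]eq_bigr => s _ do rewrite mulr_sumr.
rewrite exchange_big /=; apply: eq_bigr => s _; apply: eq_bigr => t _.
by rewrite coefC; ring.
Qed.

Lemma bilDr x y z : bil x (y + z) = bil x y + bil x z.
Proof. by rewrite bilC bilDl !(bilC x). Qed.

Lemma bilZr c x y : bil x (c *: y) = c * bil x y.
Proof. by rewrite bilC bilZl bilC. Qed.

Lemma bilNl x y : bil (- x) y = - bil x y.
Proof. by rewrite -scaleN1r bilZl mulN1r. Qed.

Lemma bilNr x y : bil x (- y) = - bil x y.
Proof. by rewrite bilC bilNl bilC. Qed.

Lemma bil_basisl s y : bil (e s) y = - lam s y.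
Proof.
rewrite /bil (bigD1 s) //= basisE eqxx mul1r big1 ?addr0 // => i it.
by rewrite basisE (negPf it) mul0r.
Qed.

Lemma bil_basis s t : bil (e s) (e t) = - coef s t.
Proof. by rewrite bil_basisl lam_basis. Qed.

Definition refl s x : V := x + lam s x *: e s.

Lemma reflD s x y : refl s (x + y) = refl s x + refl s y.
Proof. by rewrite /refl lamD scalerDl addrACA. Qed.

Lemma reflZ s c x : refl s (c *: x) = c *: refl s x.
Proof. by rewrite /refl lamZ scalerDr scalerA. Qed.

Lemma reflK s : involutive (refl s).
Proof.
move=> x; apply/ffunP => t; rewrite /refl lamD lamZ lam_basis coefss !vE; ring.
Qed.

Lemma bil_refl s x y : bil (refl s x) (refl s y) = bil x y.
Proof.
rewrite /refl !(bilDl, bilDr, bilZl, bilZr) bil_basis coefss.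
by rewrite (bilC x (e s)) !bil_basisl; ring.
Qed.

Definition actw p x : V := foldr refl x p.

Lemma actw_cat p q x : actw (p ++ q) x = actw p (actw q x).
Proof. exact: foldr_cat. Qed.

(** A closed form of (s t)^k on every vector, not only on the plane of [e s] and [e t]. At k = m,
    where U m = 0 and U (m + 1) squares to 1, it is the identity, which verifies the Coxeter
    relation. *)
Lemma actw_alternating k s t x (a := coef s t) (U := cheb a)
    (P := U k * (U k * lam s x + U k.+1 * lam t x)) : s != t ->
  actw (flatten (nseq k [:: s; t])) x =
  x + P *: e s + (lam t x + a * P - U k.+1 * (U k * lam s x + U k.+1 * lam t x)) *: e t.
Proof.
move=> st; rewrite /P {P}; elim: k => [|k IH].
  by rewrite /= /U cheb0 cheb1; apply/ffunP => r; rewrite !vE; ring.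
rewrite (_ : flatten _ = [:: s; t] ++ flatten (nseq k [:: s; t])) //.
rewrite actw_cat {}IH /= /refl !(lamD, lamZ) !lam_basis !coefss (coefC t s) -/a.
apply/ffunP => r; rewrite !vE /U !chebSS.
have := cheb_norm a k.
set X := lam s x; set Y := lam t x; set A := cheb a k; set B := cheb a k.+1.
rewrite !expr2 => N.
have {}N : B * B - 1 - a * A * B + A * A = 0 by lra.
(* [lra] treats products of variables as atoms, so the multiples of [N] that it has to combine are
   supplied. *)
have N1 : (B * B - 1 - a * A * B + A * A) * (Y * e t r) = 0 by rewrite N mul0r.
have N2 : (B * B - 1 - a * A * B + A * A) * (Y * a * e s r) = 0 by rewrite N mul0r.
have N3 : (B * B - 1 - a * A * B + A * A) * (X * e s r) = 0 by rewrite N mul0r.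
have N4 : (B * B - 1 - a * A * B + A * A) * (Y * a * a * e t r) = 0 by rewrite N mul0r.
have N5 : (B * B - 1 - a * A * B + A * A) * (X * a * e t r) = 0 by rewrite N mul0r.
lra.
Qed.

Lemma actw_rel s t x : actw (flatten (nseq (cox_m s t) [:: s; t])) x = x.
Proof.
have [->|st] := eqVneq s t.
  by case: (cox_mP C) => -> _ _; rewrite /= reflK.
have m1 : cox_m s t != 1%N by case: (cox_mP C) => _ _; apply.
case: (posnP (cox_m s t)) => [->//|m0].
have U0 : cheb (coef s t) (cox_m s t) = 0.
  by apply: cheb_eq0; rewrite ltn_neqAle eq_sym m1.
rewrite actw_alternating //; have := cheb_norm (coef s t) (cox_m s t).
rewrite {}U0 !mul0r !mulr0 mul0r add0r scale0r !addr0 expr0n subr0 => N.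
by rewrite mulrA -expr2 N mul1r subrr scale0r addr0.
Qed.

Lemma actw_equiv p q : word_equiv (@cox_m W C) p q -> actw p =1 actw q.
Proof.
elim=> // [p' q' s t|p' q' _ IH|p' q' r _ IH1 _ IH2] x.
- by rewrite !actw_cat actw_rel.
- by rewrite IH.
- by rewrite IH1.
Qed.

Fact word_exists (w : W) : exists p, word_prod g p == w.
Proof. by have [p <-] := gen_surj C w; exists p. Qed.

Definition act w : V -> V := actw (xchoose (word_exists w)).

Lemma act_word p x : act (word_prod g p) x = actw p x.
Proof.
by apply: actw_equiv; apply/gen_rel; exact/eqP/(xchooseP (word_exists _)).
Qed.

Lemma word_prod_cat p q : word_prod g (p ++ q) = (word_prod g p * word_prod g q)%g.
Proof. exact: big_cat. Qed.

Lemma word_prod_cons s p : word_prod g (s :: p) = (g s * word_prod g p)%g.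
Proof. exact: big_cons. Qed.

Lemma word_prod_nil : word_prod g [::] = 1%g.
Proof. exact: big_nil. Qed.

Lemma word_prod1 s : word_prod g [:: s] = g s.
Proof. by rewrite word_prod_cons word_prod_nil mulg1. Qed.

Lemma act1 x : act 1 x = x.
Proof. by rewrite -word_prod_nil act_word. Qed.

Lemma actM u w x : act (u * w)%g x = act u (act w x).
Proof.
have [p <-] := gen_surj C u; have [q <-] := gen_surj C w.
by rewrite -word_prod_cat !act_word actw_cat.
Qed.

Lemma act_gen s x : act (g s) x = refl s x.
Proof. by rewrite -word_prod1 act_word. Qed.

Lemma actK w : cancel (act w) (act w^-1%g).
Proof. by move=> x; rewrite -actM mulVg act1. Qed.

Lemma actVK w : cancel (act w^-1%g) (act w).
Proof. by move=> x; rewrite -actM mulgV act1. Qed.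

Lemma actD w x y : act w (x + y) = act w x + act w y.
Proof.
have [p <-] := gen_surj C w; rewrite !act_word.
by elim: p => //= s p ->; rewrite reflD.
Qed.

Lemma act0 w : act w (0 : V) = 0.
Proof. by apply: (addrI (act w 0)); rewrite -actD !addr0. Qed.

Lemma actZ w c x : act w (c *: x) = c *: act w x.
Proof.
have [p <-] := gen_surj C w; rewrite !act_word.
by elim: p => //= s p ->; rewrite reflZ.
Qed.

Lemma actN w x : act w (- x) = - act w x.
Proof. by rewrite -!scaleN1r actZ. Qed.

Lemma bil_act w x y : bil (act w x) (act w y) = bil x y.
Proof.
have [p <-] := gen_surj C w; rewrite !act_word.
by elim: p => //= s p; rewrite bil_refl.
Qed.

Lemma bil_actl w x y : bil (act w x) y = bil x (act w^-1%g y).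
Proof. by rewrite -(bil_act w^-1%g) actK. Qed.

Lemma bil_root w s : bil (act w (e s)) (act w (e s)) = 2.
Proof. by rewrite bil_act bil_basis coefss opprK. Qed.

Lemma act_reflection u s x :
  act (u * g s * u^-1)%g x = x - bil x (act u (e s)) *: act u (e s).
Proof.
rewrite !actM act_gen /refl actD actVK actZ; congr (_ + _).
by rewrite -scaleNr bilC bil_actl bil_basisl opprK.
Qed.

Lemma refl_basis s : refl s (e s) = - e s.
Proof. by apply/ffunP => t; rewrite /refl lam_basis coefss !vE; ring. Qed.

Lemma gen_sq s : (g s * g s = 1)%g.
Proof.
have : word_prod g ([::] ++ flatten (nseq (cox_m s s) [:: s; s]) ++ [::]) =
       word_prod g ([::] ++ [::]) by apply/gen_rel; exact: WordRel.
case: (cox_mP C) => -> _ _ /=.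
by rewrite word_prod_cons word_prod1 word_prod_nil.
Qed.

Lemma genV s : ((g s)^-1 = g s)%g.
Proof. by apply: (mulgI (g s)); rewrite mulgV gen_sq. Qed.

Lemma genK s w : (g s * (g s * w) = w)%g.
Proof. by rewrite mulgA gen_sq mul1g. Qed.

Lemma mulg_genK s w : (w * g s * g s = w)%g.
Proof. by rewrite -mulgA gen_sq mulg1. Qed.

Lemma word_prod_rev p : word_prod g (rev p) = ((word_prod g p)^-1)%g.
Proof.
elim: p => [|s p IH]; first by rewrite word_prod_nil invg1.
by rewrite rev_cons -cats1 word_prod_cat word_prod1 IH word_prod_cons invgM genV.
Qed.

Lemma cox_relation s t : (((g s * g t) ^+ (cox_m s t)) = 1)%g.
Proof.
have : word_prod g ([::] ++ flatten (nseq (cox_m s t) [:: s; t]) ++ [::]) =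
       word_prod g ([::] ++ [::]) by apply/gen_rel; exact: WordRel.
rewrite !cats0 word_prod_nil => <-.
elim: (cox_m s t) => [|k IH]; first by rewrite word_prod_nil.
by rewrite expgS IH /= !word_prod_cons mulgA.
Qed.

(** With a = [coef s t], the coordinates at s of s t e_s and t s e_s are a^2 - 1 and -1. *)
Lemma coef_commute s t : s != t -> (g s * g t = g t * g s)%g -> coef s t = 0.
Proof.
move=> st /(congr1 (fun w => act w (e s) s)).
rewrite /= !actM !act_gen /refl !(lamD, lamZ, lam_basis) !vE !basisE.
rewrite eqxx (negPf st) (coefC t s) !coefss mulr1n mulr0n => h.
have : coef s t * coef s t = 0 by lra.
by move/eqP; rewrite mulf_eq0 orbb => /eqP.
Qed.

Lemma coef_noncommute s t : s != t -> (g s * g t != g t * g s)%g -> 1 <= coef s t.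
Proof.
move=> st nst; rewrite /coef; apply: cox_coef_ge1.
  by case: (cox_mP C) => _ _; apply.
apply: contra nst => /eqP m2; have := cox_relation s t.
rewrite m2 expgS expg1 => h; apply/eqP.
by rewrite -[LHS](mulgK (g s * g t))%g h mul1g invgM !genV.
Qed.

End GeometricRepresentation.

(** * Lengths, roots and inversions *)

(* [lia] alone does not treat lengths of group elements as atoms. *)
Ltac len_lia :=
  repeat match goal with
  | H : is_true (leq _ _) |- _ => revert H
  | H : is_true (~~ leq _ _) |- _ => revert H
  | H : @eq ?T _ _ |- _ => unify T nat; revert H
  end;
  repeat (let x := fresh "l" in set x := cox_length _ _; move: x);
  lia.

Section Length.

Variables (W : groupType) (C : coxeterSystem W).
Local Notation S := (simple_refl C).
Local Notation g := (@gen W C).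
Local Notation len := (@cox_length W C).
Implicit Types (s t : S) (u v w : W) (p q : seq S).

Lemma len_word p : (len (word_prod g p) <= size p)%N.
Proof.
rewrite /cox_length; case: ex_minnP => k _; apply.
by apply/existsP; exists (in_tuple p).
Qed.

Lemma len_red w : exists2 p, word_prod g p = w & size p = len w.
Proof.
rewrite /cox_length; case: ex_minnP => k /existsP[p /eqP <-] _.
by exists p; rewrite ?size_tuple.
Qed.

Lemma len1 : len 1%g = 0%N.
Proof. by apply/eqP; rewrite -leqn0 -(word_prod_nil C) len_word. Qed.

Lemma len_eq0 w : len w = 0%N -> w = 1%g.
Proof. by have [p <-] := len_red w => <- /size0nil ->; rewrite word_prod_nil. Qed.

Lemma lenM u w : (len (u * w)%g <= len u + len w)%N.
Proof.
have [p <- <-] := len_red u; have [q <- <-] := len_red w.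
by rewrite -word_prod_cat -size_cat len_word.
Qed.

Lemma lenV w : len w^-1%g = len w.
Proof.
have le u : (len u^-1%g <= len u)%N.
  by have [p <- <-] := len_red u; rewrite -word_prod_rev -size_rev len_word.
by apply/eqP; rewrite eqn_leq le -{1}[w]invgK le.
Qed.

Lemma word_equiv_odd p q : word_equiv (@cox_m W C) p q -> odd (size p) = odd (size q).
Proof.
elim=> [p' q' s t|//|p' q' _ ->//|p' q' r _ -> _ ->//].
rewrite !size_cat !oddD; congr (_ (+) _); rewrite -[RHS]addFb; congr (_ (+) _).
by elim: (cox_m s t) => //= k; rewrite negbK.
Qed.

Lemma odd_len p : odd (len (word_prod g p)) = odd (size p).
Proof.
have [q qp <-] := len_red (word_prod g p).
exact/word_equiv_odd/gen_rel.
Qed.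

Lemma odd_lenM u w : odd (len (u * w)%g) = odd (len u) (+) odd (len w).
Proof.
have [p <-] := gen_surj C u; have [q <-] := gen_surj C w.
by rewrite -word_prod_cat !odd_len size_cat oddD.
Qed.

Lemma len_gen s : len (g s) = 1%N.
Proof.
have := odd_len [:: s]; have := len_word [:: s].
by rewrite word_prod1; case: (len _) => [|[]].
Qed.

Lemma len_mulg_gen w s : len (w * g s)%g = (len w).+1 \/ len w = (len (w * g s)%g).+1.
Proof.
have := lenM w (g s); have := lenM (w * g s)%g (g s); have := odd_lenM w (g s).
rewrite mulg_genK len_gen /=; len_lia.
Qed.

Lemma len_gen_mulg s w : len (g s * w)%g = (len w).+1 \/ len w = (len (g s * w)%g).+1.
Proof.
have := len_mulg_gen w^-1%g s.
by rewrite (_ : w^-1 * g s = (g s * w)^-1)%g ?lenV // invgM genV.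
Qed.

Lemma exists_rdescent w : w != 1%g -> exists s, (len (w * g s)%g < len w)%N.
Proof.
have [p pw sp] := len_red w; case/lastP: p pw sp => [<-|p s pw sp w1].
  by rewrite word_prod_nil eqxx.
exists s; rewrite -sp size_rcons ltnS -pw -cats1 word_prod_cat word_prod1 mulg_genK.
exact: len_word.
Qed.

Fixpoint alt (k : nat) s t : W := if k is k'.+1 then (alt k' t s * g s)%g else 1%g.

Lemma alt_left k s t :
  alt k.+1 t s = (g (if odd k then s else t) * alt k t s)%g.
Proof.
elim: k s t => [|k IH] s t; first by rewrite /= mul1g mulg1.
by rewrite -[alt k.+2 t s]/(alt k.+1 s t * g t)%g IH -mulgA /=; case: odd.
Qed.

Lemma alt_pow k s t :
  alt k.*2 s t = ((g t * g s) ^+ k)%g /\ alt k.*2.+1 s t = (g s * (g t * g s) ^+ k)%g.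
Proof.
elim: k s t => [|k IH] s t; first by rewrite /= !mulg1 mul1g.
have [e1 e2] := IH s t; rewrite doubleS.
have e3 : alt k.*2.+2 s t = ((g t * g s) ^+ k.+1)%g.
  by rewrite alt_left /= odd_double /= expgS -mulgA -e2.
split=> //; rewrite alt_left e3 /= odd_double //.
Qed.

Lemma alt_cox s t : (0 < cox_m s t)%N -> alt (cox_m s t) s t = alt (cox_m s t) t s.
Proof.
move=> _; have := cox_relation s t; move: (cox_m s t) => m.
have [j [->|->]] : exists j, m = j.*2 \/ m = j.*2.+1.
  by exists m./2; have := odd_double_half m; case: (odd m) => h; [right|left]; rewrite -[LHS]h.
  move=> st1; have [-> _] := alt_pow j s t; have [-> _] := alt_pow j t s.
  have -> : ((g t * g s) ^+ j = ((g s * g t) ^+ j)^-1)%g.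
    by rewrite -expVgn invgM !genV.
  by apply: (mulgI ((g s * g t) ^+ j)%g); rewrite mulgV -expgnDr addnn st1.
move=> st1; have [_ ->] := alt_pow j s t; have [_ ->] := alt_pow j t s.
have -> : ((g t * g s) ^+ j = ((g s * g t) ^+ j)^-1)%g.
  by rewrite -expVgn invgM !genV.
apply: (mulgI ((g s * g t) ^+ j * g s)%g).
by rewrite -!mulgA genK mulgV (mulgA (g s)) -expgS -expgnDr addnS addnn st1.
Qed.

Lemma alt_suffix k j s t : exists2 a, alt (j + k) t s = (a * alt k t s)%g & (len a <= j)%N.
Proof.
elim: j => [|j [a e la]]; first by exists 1%g; rewrite ?mul1g ?len1.
exists (g (if odd (j + k) then s else t) * a)%g.
  by rewrite addSn alt_left e mulgA.
by apply: leq_trans (lenM _ _) _; rewrite len_gen add1n ltnS.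
Qed.

Lemma len_alt k s t : (len (alt k s t) <= k)%N.
Proof.
elim: k s t => [|k IH] s t; first by rewrite len1.
by apply: leq_trans (lenM _ _) _; rewrite len_gen addn1 ltnS.
Qed.

Lemma act_alt k s t : s != t -> act (alt k t s) (basis s) =
  cheb (coef s t) k.+1 *: basis (if odd k then t else s) +
  cheb (coef s t) k *: basis (if odd k then s else t).
Proof.
move=> st; elim: k => [|k IH].
  by rewrite act1 cheb0 cheb1 scale0r addr0 scale1r.
rewrite alt_left actM IH act_gen chebSS /=.
set U := cheb _ k.+1; set U' := cheb _ k.
apply/ffunP => r; rewrite /refl !(lamD, lamZ, lam_basis).
by case: odd => /=; rewrite !vE coefss ?(coefC t s); ring.
Qed.

(* Write w = v a with a an alternating word in s and t, ending in t and of
   maximal length such that the lengths add up. *)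
Lemma act_basis_nonneg w s : (len w < len (w * g s)%g)%N -> nonneg (act w (basis s)).
Proof.
elim/(@ltn_ind): {w}(len w) {-2}w (erefl (len w)) s => n IH w wn s ws.
have [->|w1] := eqVneq w 1%g; first by rewrite act1; exact: nonneg_basis.
have [t wt] := exists_rdescent w1.
have st : s != t by apply: contraTneq wt => <-; rewrite -leqNgt ltnW.
pose P k := (len (w * (alt k t s)^-1)%g + k == len w)%N.
have P1 : exists k, P k.
  exists 1%N; rewrite /P /= mul1g genV; apply/eqP.
  by have := len_mulg_gen w t; len_lia.
have Pmax k : P k -> (k <= len w)%N by move=> /eqP <-; rewrite leq_addl.
case: (ex_maxnP P1 Pmax) => k /eqP lk kmax.
have k0 : (0 < k)%N.
  apply: (kmax 1%N); rewrite /P /= mul1g genV; apply/eqP.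
  by have := len_mulg_gen w t; len_lia.
have {lk} [v wE lk] : exists2 v, w = (v * alt k t s)%g & (len v + k = len w)%N.
  by exists (w * (alt k t s)^-1)%g; rewrite ?mulgVK.
have vn : (len v < n)%N by lia.
(* For k >= m the braid relation would rewrite the alternating tail of w so that it ends in s, and w
   s would be shorter than w. *)
have km : (0 < cox_m s t -> k < cox_m s t)%N.
  move=> m0; rewrite ltnNge; apply/negP => mk.
  have [a] := alt_suffix (cox_m s t) (k - cox_m s t) s t; rewrite subnK // => ak la.
  have {}ak : (alt k t s * g s = a * alt (cox_m s t).-1 t s)%g.
    by rewrite ak -alt_cox // -{1}(prednK m0) /= -!mulgA gen_sq mulg1.
  have := lenM v (a * alt (cox_m s t).-1 t s)%g.
  have := lenM a (alt (cox_m s t).-1 t s)%g; have := len_alt (cox_m s t).-1 t s.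
  rewrite -ak mulgA -wE; len_lia.
(* A descent of v at this letter would lengthen the alternating tail, against the maximality of
   k. *)
have up : nonneg (act v (basis (if odd k then s else t))).
  apply: (IH _ vn) => //; rewrite ltnNge; apply/negP => le.
  have : (k < k)%N; last by rewrite ltnn.
  apply: kmax; rewrite /P alt_left invgM genV mulgA [in X in (X / _)%g]wE mulgK; apply/eqP.
  have := len_mulg_gen v (if odd k then s else t); len_lia.
(* Here the letter is the first one of the tail; a descent of v there would make w shorter than
   [len v + k]. *)
have down : nonneg (act v (basis (if odd k then t else s))).
  apply: (IH _ vn) => //; rewrite ltnNge; apply/negP => le.
  case: k k0 lk wE vn {kmax km up} le => // k _ lk wE vn le.
  have := lenM (v * g (if odd k.+1 then t else s))%g (alt k t s).
  have := len_alt k t s; have := len_mulg_gen v (if odd k.+1 then t else s).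
  have -> : (v * g (if odd k.+1 then t else s) * alt k t s)%g = w.
    rewrite wE alt_left mulgA; congr (_ * _ * _)%g => /=; by case: odd.
  len_lia.
have m1 : cox_m s t != 1%N by case: (cox_mP C) => _ _; apply.
rewrite wE actM act_alt // actD !actZ; apply: nonnegD; apply: nonnegZ => //.
(* In the boundary case k + 1 = m this coefficient vanishes instead of being positive. *)
- have [kS|] := eqVneq k.+1 (cox_m s t).
    by rewrite kS /coef cheb_eq0 // -kS ltnS.
  move=> kS; apply/ltW/cheb_gt0 => // /km km'.
  by rewrite ltn_neqAle kS.
- exact/ltW/cheb_gt0.
Qed.

End Length.

(** * Roots, their signs and inversions *)

Section Roots.

Variables (W : groupType) (C : coxeterSystem W).
Local Notation S := (simple_refl C).
Local Notation V := (vect S).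
Local Notation g := (@gen W C).
Local Notation e := (@basis S).
Local Notation len := (@cox_length W C).
Local Notation "u <=_w w" := (weak_le C u w) (at level 70).
Implicit Types (s t : S) (u v w : W) (p q : seq S) (x y : V).

Definition is_root x := exists w s, x = act w (e s).

Lemma root_act w x : is_root x -> is_root (act w x).
Proof. by move=> [u [s ->]]; exists (w * u)%g, s; rewrite actM. Qed.

Lemma root_basis s : is_root (e s).
Proof. by exists 1%g, s; rewrite act1. Qed.

Lemma rootN x : is_root x -> is_root (- x).
Proof.
move=> [w [s ->]]; exists (w * g s)%g, s.
by rewrite actM act_gen refl_basis actN.
Qed.

Lemma root_bil x : is_root x -> bil x x = 2.
Proof. by move=> [w [s ->]]; exact: bil_root. Qed.

Lemma root_neq0 x : is_root x -> x <> 0.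
Proof.
move=> /root_bil h x0; move: h; rewrite {}x0 -(scale0r (0 : V)) bilZl mul0r => /eqP.
by rewrite eq_sym pnatr_eq0.
Qed.

Lemma act_basis_nonpos w s : (len (w * g s)%g < len w)%N -> nonneg (- act w (e s)).
Proof.
move=> h; have := @act_basis_nonneg _ C (w * g s)%g s.
by rewrite mulg_genK actM act_gen refl_basis actN; apply.
Qed.

Lemma root_sign x : is_root x -> nonneg x \/ nonneg (- x).
Proof.
move=> [w [s ->]]; case: (len_mulg_gen w s) => h.
  by left; apply: act_basis_nonneg; rewrite h.
by right; apply: act_basis_nonpos; rewrite h.
Qed.

Lemma root_sign_excl x : is_root x -> nonneg x -> nonneg (- x) -> False.
Proof. by move=> rx x0 /(nonneg_anti x0); exact: root_neq0. Qed.

Definition pos_root x := is_root x /\ nonneg x.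

Lemma pos_basis s : pos_root (e s).
Proof. by split; [exact: root_basis | exact: nonneg_basis]. Qed.

Lemma refl_other s t x : t != s -> refl s x t = x t.
Proof. by move=> ts; rewrite /refl !vE basisE (negPf ts) mulr0 addr0. Qed.

(** Only the coordinate at s changes, so if x became negative it would be supported at s; norm 2
    then makes it [e s]. *)
Lemma refl_pos s x : pos_root x -> x <> e s -> pos_root (refl s x).
Proof.
move=> [rx x0] xs; have rsx : is_root (refl s x) by rewrite -act_gen; exact: root_act.
split=> //; case: (root_sign rsx) => // sN; case: xs.
have xE : x = x s *: e s.
  apply/ffunP => t; rewrite vE basisE; have [->|ts] := eqVneq t s; first by rewrite mulr1.
  rewrite mulr0; apply/le_anti; rewrite x0 andbT.
  by have := sN t; rewrite vE refl_other // oppr_ge0.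
have := root_bil rx; rewrite xE bilZl bilZr bil_basis coefss => h.
have := x0 s; move: h; set c := x s => h c0.
have : (c - 1) * (c + 1) = 0 by lra.
move=> /eqP; rewrite mulf_eq0 (@gt_eqF _ _ (c + 1)) ?orbF; last by lra.
by rewrite subr_eq0 => /eqP ->; rewrite scale1r.
Qed.

Definition inv w x := pos_root x /\ nonneg (- act w^-1%g x).

Lemma inv1 x : ~ inv 1%g x.
Proof. by move=> [[rx x0]]; rewrite invg1 act1; exact: root_sign_excl. Qed.

Lemma not_inv w x : pos_root x -> ~ inv w x -> nonneg (act w^-1%g x).
Proof. by move=> px nx; case: (root_sign (root_act w^-1%g px.1)) => // h; case: nx. Qed.

Lemma inv_comb w a b x y z : pos_root z -> 0 <= a -> 0 <= b -> inv w x -> inv w y ->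
  z = a *: x + b *: y -> inv w z.
Proof.
move=> pz a0 b0 [_ ix] [_ iy] zE; split=> //.
rewrite zE actD !actZ opprD -!scalerN.
by apply: nonnegD; apply: nonnegZ.
Qed.

Definition ldesc s w := (len (g s * w)%g < len w)%N.

Lemma ldescP s w : reflect (inv w (e s)) (ldesc s w).
Proof.
rewrite /ldesc -lenV -[len w]lenV invgM genV; apply: (iffP idP) => h.
  by split; [exact: pos_basis | exact: act_basis_nonpos].
case: (len_mulg_gen w^-1%g s) => [l|->//].
case: h => _ hN; case: (root_sign_excl (root_act w^-1%g (root_basis s))) => //.
by apply: act_basis_nonneg; rewrite l.
Qed.

Lemma len_ldesc s w : ldesc s w -> len w = (len (g s * w)%g).+1.
Proof. by rewrite /ldesc; case: (len_gen_mulg s w) => ->; len_lia. Qed.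

Lemma len_nldesc s w : ~~ ldesc s w -> len (g s * w)%g = (len w).+1.
Proof. by rewrite /ldesc; case: (len_gen_mulg s w) => ->; len_lia. Qed.

Lemma ldesc_mul s w : ldesc s (g s * w)%g = ~~ ldesc s w.
Proof. by rewrite /ldesc genK; case: (len_gen_mulg s w) => ->; len_lia. Qed.

Lemma inv_mulgl s w x : ~~ ldesc s w -> inv (g s * w)%g x <-> x = e s \/ inv w (refl s x).
Proof.
move=> ns; have act_s y : act (g s * w)^-1%g y = act w^-1%g (refl s y).
  by rewrite invgM genV actM act_gen.
split=> [[px h]|].
  have [xs|/eqP xs] := eqVneq x (e s); [by left | right].
  by split; [exact: refl_pos | rewrite -act_s].
case=> [->|[px h]]; first by apply/ldescP; rewrite ldesc_mul.
split; last by rewrite act_s.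
rewrite -[x](reflK s); apply: refl_pos => // sx.
by move/negP: ns; apply; apply/ldescP; rewrite -sx.
Qed.

Lemma inv_mulgl_desc s w x : ldesc s w -> inv w x <-> x = e s \/ inv (g s * w)%g (refl s x).
Proof. by move=> sw; rewrite -{1}(genK s w); apply: inv_mulgl; rewrite ldesc_mul negbK. Qed.

Lemma inv_mulgr s w x : (len w < len (w * g s)%g)%N ->
  inv (w * g s)%g x <-> inv w x \/ x = act w (e s).
Proof.
move=> ws; have act_s y : act (w * g s)^-1%g y = refl s (act w^-1%g y).
  by rewrite invgM genV actM act_gen.
have pws : pos_root (act w (e s)).
  by split; [apply/root_act/root_basis | exact: act_basis_nonneg].
split=> [[px h]|[[px h]|->]].
- have [xs|/eqP xs] := eqVneq x (act w (e s)); [by right | left].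
  split=> //; have rx := root_act w^-1%g px.1; case: (root_sign rx) => // wx0.
  have := @refl_pos s (act w^-1%g x) (conj rx wx0); rewrite -act_s => -[].
    by move=> ee; apply: xs; rewrite -ee actVK.
  by move=> r1 r2; case: (root_sign_excl r1 r2).
- split=> //; rewrite act_s -act_gen -actN act_gen.
  apply: (refl_pos _ _).2; first by split=> //; apply/rootN/root_act/px.1.
  move=> ee; have xE : x = - act w (e s) by rewrite -ee actN opprK actVK.
  apply: (root_sign_excl px.1 px.2).
  by rewrite xE opprK; exact: pws.2.
- by split=> //; rewrite act_s actK refl_basis opprK; exact: nonneg_basis.
Qed.

End Roots.

(** * The weak order *)

Section WeakOrder.

Variables (W : groupType) (C : coxeterSystem W).
Local Notation S := (simple_refl C).
Local Notation V := (vect S).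
Local Notation g := (@gen W C).
Local Notation e := (@basis S).
Local Notation len := (@cox_length W C).
Local Notation wle := (@weak_le W C).
Implicit Types (s t : S) (u v w : W) (p q : seq S) (x y : V) (J K : {set S}).

Lemma exists_ldesc w : w != 1%g -> exists s, ldesc s w.
Proof.
move=> w1; have w'1 : w^-1%g != 1%g by apply: contra w1 => /eqP h; rewrite -[w]invgK h invg1.
have [s] := exists_rdescent C w'1; rewrite -lenV invgM invgK genV lenV => h.
by exists s.
Qed.

Lemma inv_prefix u v x : len (u * v)%g = (len u + len v)%N -> inv u x -> inv (u * v)%g x.
Proof.
have [n] := ubnP (len v); elim: n v => // n IH v vn uv ux.
have [v1|v1] := eqVneq v 1%g; first by rewrite v1 mulg1.
have [s vs] := exists_rdescent C v1.
have vE : v = (v * g s * g s)%g by rewrite mulg_genK.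
have lv : len v = (len (v * g s)%g).+1 by case: (len_mulg_gen v s) vs => ->; len_lia.
have := lenM C u (v * g s)%g; have := lenM C (u * (v * g s))%g (g s).
rewrite -mulgA -vE len_gen => l1 l2.
have l3 : len (u * (v * g s))%g = (len u + len (v * g s)%g)%N by len_lia.
rewrite vE mulgA; apply/inv_mulgr; first by rewrite -mulgA -vE; len_lia.
left; apply: IH => //; len_lia.
Qed.

(** For the converse, a left descent of u is a simple inversion of u, hence of w; it can be stripped
    from both, and the inclusion of inversions survives. *)
Lemma weak_leP u w : wle u w <-> (forall x, inv u x -> inv w x).
Proof.
split=> [/eqP uw x|].
  by rewrite -{1}(mulVKg u w); apply: inv_prefix; rewrite mulVKg -uw.
have [n] := ubnP (len u); elim: n u w => // n IH u w un uw.
have [->|u1] := eqVneq u 1%g; first by rewrite /weak_le invg1 mul1g len1 add0n.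
have [s su] := exists_ldesc u1.
have sw : ldesc s w by apply/ldescP/uw/ldescP.
have lu := len_ldesc su; have lw := len_ldesc sw.
have /eqP : wle (g s * u)%g (g s * w)%g.
  apply: IH => [|x]; first by len_lia.
  rewrite -{1}(reflK s x) => sux.
  have : inv u (refl s x) by apply/(inv_mulgl_desc _ su); right.
  move=> /uw /(inv_mulgl_desc _ sw) [xs|]; last by rewrite reflK.
  case: sux => -[_]; rewrite xs refl_basis => h _.
  by case: (root_sign_excl (root_basis s) (nonneg_basis s)).
by rewrite invgM genV -mulgA genK => h; apply/eqP; len_lia.
Qed.

Lemma wle_refl w : wle w w.
Proof. exact/weak_leP. Qed.

Lemma wle_trans u v w : wle u v -> wle v w -> wle u w.
Proof. by move=> /weak_leP uv /weak_leP vw; apply/weak_leP => x /uv/vw. Qed.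

Lemma wle1 w : wle 1%g w.
Proof. by apply/weak_leP => x /inv1. Qed.

Lemma wle_len u w : wle u w -> (len u <= len w)%N.
Proof. by move=> /eqP <-; rewrite leq_addr. Qed.

Lemma wle_lt u w : wle u w -> u <> w -> (len u < len w)%N.
Proof.
move=> /eqP h uw; rewrite -h -addn1 leq_add2l lt0n; apply/eqP => /len_eq0 h1; apply: uw.
by apply: (mulgI u^-1%g); rewrite h1 mulVg.
Qed.

Lemma wle_anti u w : wle u w -> wle w u -> u = w.
Proof.
move=> uw wu; apply: NNPP => /(wle_lt uw); have := wle_len wu; len_lia.
Qed.

Lemma ldesc_wle s u w : wle u w -> ldesc s u -> ldesc s w.
Proof. by move=> /weak_leP uw /ldescP /uw /ldescP. Qed.

Lemma wle_gen s w : wle (g s) w = ldesc s w.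
Proof.
rewrite /weak_le /ldesc len_gen genV add1n.
by case: (len_gen_mulg s w) => ->; len_lia.
Qed.

Lemma wle_mulgl s u w : ~~ ldesc s u -> ~~ ldesc s w -> wle (g s * u)%g (g s * w)%g = wle u w.
Proof.
move=> su sw; rewrite /weak_le invgM genV -mulgA genK (len_nldesc su) (len_nldesc sw).
by rewrite addSn eqSS.
Qed.

Lemma wle_mulgl_desc s u w : ldesc s u -> ldesc s w -> wle (g s * u)%g (g s * w)%g = wle u w.
Proof.
move=> su sw; rewrite -[in RHS](genK s u) -[in RHS](genK s w) [RHS]wle_mulgl //.
  by rewrite ldesc_mul negbK.
by rewrite ldesc_mul negbK.
Qed.

Lemma act_trivial w : (forall x, act w x = x) -> w = 1%g.
Proof.
move=> h; apply: NNPP => /eqP /exists_ldesc[s /ldescP[_]].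
have -> : act w^-1%g (e s) = e s by rewrite -{1}(h (e s)) actK.
by move=> h'; apply: (root_sign_excl (root_basis s)) h'; exact: nonneg_basis.
Qed.

Lemma act_faithful u w : (forall x, act u x = act w x) -> u = w.
Proof.
move=> h; apply: (mulgI w^-1%g); rewrite mulVg; apply: act_trivial => x.
by rewrite actM h actK.
Qed.

Lemma inv_finite w : exists2 l : seq V, size l = len w & forall x, inv w x -> x \in l.
Proof.
have [n] := ubnP (len w); elim: n w => // n IH w wn.
have [->|w1] := eqVneq w 1%g; first by exists [::]; rewrite ?len1 // => x /inv1.
have [s sw] := exists_ldesc w1; have lw := len_ldesc sw.
have [|l sl hl] := IH (g s * w)%g; first by len_lia.
exists (e s :: map (refl s) l); first by rewrite /= size_map sl.
move=> x /(inv_mulgl_desc _ sw) [->|/hl h]; first exact: mem_head.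
by rewrite inE -[x](reflK s) (mem_map (can_inj (reflK s))) h orbT.
Qed.

(** * Standard parabolic subgroups and components *)

Definition in_par J w := exists2 p, all (mem J) p & word_prod g p = w.

Lemma par1 J : in_par J 1%g.
Proof. by exists [::]; rewrite ?word_prod_nil. Qed.

Lemma par_gen J s : s \in J -> in_par J (g s).
Proof. by move=> sJ; exists [:: s]; rewrite ?word_prod1 //= andbT. Qed.

Lemma parM J u w : in_par J u -> in_par J w -> in_par J (u * w)%g.
Proof.
move=> [p pJ <-] [q qJ <-]; exists (p ++ q); last by rewrite word_prod_cat.
by rewrite all_cat pJ.
Qed.

Lemma parV J w : in_par J w -> in_par J w^-1%g.
Proof. by move=> [p pJ <-]; exists (rev p); rewrite ?all_rev ?word_prod_rev. Qed.

Lemma parT w : in_par setT w.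
Proof. by have [p <-] := gen_surj C w; exists p => //; apply/allP => s; rewrite inE. Qed.

Lemma act_par_out J w t x : in_par J w -> t \notin J -> act w x t = x t.
Proof.
move=> [p pJ <-] tJ; rewrite act_word.
elim: p pJ => //= s p IH /andP[sJ /IH <-]; rewrite refl_other //.
by apply: contra tJ => /eqP ->.
Qed.

Lemma act_par_supported J w x : in_par J w -> supported J x -> supported J (act w x).
Proof. by move=> wJ xJ t tJ; rewrite (act_par_out _ wJ) // xJ. Qed.

Lemma inv_par J w x : in_par J w -> inv w x -> supported J x.
Proof.
move=> wJ [[_ x0] h] t tJ; have := h t.
rewrite vNE (act_par_out _ (parV wJ)) // oppr_ge0 => h'.
by apply/le_anti; rewrite h' x0.
Qed.

Lemma vect_sum x : x = \sum_s x s *: e s.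
Proof.
apply/ffunP => t; rewrite sum_ffunE (bigD1 t) //= vE basisE eqxx mulr1 big1 ?addr0 //.
by move=> s st; rewrite vE basisE eq_sym (negPf st) mulr0.
Qed.

Lemma act_nonneg J v x : (forall s, s \in J -> nonneg (act v (e s))) ->
  nonneg x -> supported J x -> nonneg (act v x).
Proof.
move=> vJ x0 xJ; rewrite (vect_sum x).
rewrite (big_morph _ (actD v) (act0 C v)) => t; rewrite sum_ffunE; apply: sumr_ge0 => s _.
rewrite actZ vE; case: (boolP (s \in J)) => [/vJ h|/xJ ->]; last by rewrite mul0r.
by rewrite mulr_ge0.
Qed.

Lemma par_decomp J w :
  exists u v, [/\ w = (u * v)%g, in_par J u & forall s, s \in J -> ~~ ldesc s v].
Proof.
have [n] := ubnP (len w); elim: n w => // n IH w wn.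
case: (pickP [pred s in J | ldesc s w]) => [s /andP[sJ sw]|h]; last first.
  exists 1%g, w; split=> [||s sJ]; rewrite ?mul1g //; first exact: par1.
  by have := h s; rewrite inE sJ /= => ->.
have lw := len_ldesc sw; have [|u [v [uv uJ vJ]]] := IH (g s * w)%g; first by len_lia.
exists (g s * u)%g, v; split=> //; first by rewrite -mulgA -uv genK.
exact/parM/uJ/par_gen.
Qed.

(** Since v has no left descent in J, its inverse sends every nonnegative vector supported on J to a
    nonnegative one. The sign of such a root under the inverse of u v is therefore decided by u
    alone. *)
Lemma inv_par_decomp J u v x : in_par J u -> (forall s, s \in J -> ~~ ldesc s v) ->
  inv u x <-> inv (u * v)%g x /\ supported J x.
Proof.
move=> uJ vJ.
have v0 s : s \in J -> nonneg (act v^-1%g (e s)).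
  move=> /vJ sv; apply: not_inv; first exact: pos_basis.
  by move/ldescP; apply/negP.
split=> [ux|[[px ux] xJ]].
  have xJ := inv_par uJ ux; split=> //; case: ux => px h; split=> //.
  rewrite invgM actM -actN; apply: act_nonneg v0 _ _ => //.
  by apply: supportedN; apply: act_par_supported xJ; apply: parV.
split=> //; apply: NNPP => h.
have h0 : nonneg (act u^-1%g x) by apply: not_inv => // -[].
have := act_nonneg v0 h0 (act_par_supported (parV uJ) xJ).
rewrite -actM -invgM => h1; apply: root_sign_excl h1 ux.
exact: root_act px.1.
Qed.

Lemma par_proj J w : exists2 u, in_par J u & forall x, inv u x <-> inv w x /\ supported J x.
Proof.
have [u [v [-> uJ vJ]]] := par_decomp J w.
by exists u => // x; apply: inv_par_decomp.
Qed.

Lemma in_parP J w : in_par J w <-> (forall x, inv w x -> supported J x).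
Proof.
split=> [wJ x|h]; first exact: inv_par.
have [u uJ hu] := par_proj J w.
by have -> : w = u by apply: wle_anti; apply/weak_leP => x; [move=> wx; apply/hu; split; auto | case/hu].
Qed.

Lemma par_le J u w : wle u w -> in_par J w -> in_par J u.
Proof. by move=> /weak_leP uw /in_parP h; apply/in_parP => x /uw/h. Qed.

Lemma parS J K w : J \subset K -> in_par J w -> in_par K w.
Proof. by move=> JK /in_parP h; apply/in_parP => x /h; exact: supportedW. Qed.

Lemma par_ldesc J s w : in_par J w -> ldesc s w -> s \in J.
Proof.
move=> wJ /ldescP /(inv_par wJ) h; apply: contraT => /h.
by rewrite basisE eqxx => /eqP; rewrite oner_eq0.
Qed.

Lemma par0 w : in_par set0 w -> w = 1%g.
Proof.
move=> w0; apply: NNPP => /eqP/exists_ldesc[s] /(par_ldesc w0).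
by rewrite inE.
Qed.

Lemma supported_pair s t x : s != t -> supported [set s; t] x -> x = x s *: e s + x t *: e t.
Proof.
move=> st xK; apply/ffunP => r; rewrite !vE !basisE.
have [->|rs] := eqVneq r s; first by rewrite (negPf st) mulr0 mulr1 addr0.
have [->|rt] := eqVneq r t; first by rewrite mulr0 mulr1 add0r.
by rewrite xK ?mulr0 ?addr0 // !inE (negPf rs).
Qed.

Lemma inv_pair w s t x : ldesc s w -> ldesc t w -> pos_root x -> supported [set s; t] x ->
  inv w x.
Proof.
have [->|st] := eqVneq s t.
  move=> _ /ldescP tw px xt; apply: (inv_comb px (px.2 t) (lexx 0) tw tw).
  apply/ffunP => r; rewrite !vE !basisE mul0r addr0.
  by have [->|rt] := eqVneq r t; rewrite ?mulr1 // mulr0 xt // !inE orbb.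
move=> /ldescP sw /ldescP tw px xK.
exact: (inv_comb px (px.2 s) (px.2 t) sw tw (supported_pair st xK)).
Qed.

(** For each s below all of A, cancelling s gives by induction the largest among the lower bounds
    above s. These candidates coincide for different s, so they bound every lower bound. *)
Theorem meet_exists (A : W -> Prop) : (exists a, A a) -> exists m, is_meet C A m.
Proof.
move=> [a0 Aa0]; have [n] := ubnP (len a0); elim: n A a0 Aa0 => // n IH A a0 Aa0 an.
pose lower u := forall a, A a -> wle u a.
pose D s := forall a, A a -> ldesc s a.
have lowerD s u : lower u -> ldesc s u -> D s by move=> lu su a /lu /ldesc_wle; apply.
have best s : D s -> exists m, [/\ lower m, ldesc s m & forall u, lower u -> ldesc s u -> wle u m].
  move=> Ds; have sa0 := Ds _ Aa0; have la0 := len_ldesc sa0.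
  have [||m [m1 m2]] := IH (fun v => A (g s * v)%g) (g s * a0)%g; rewrite ?genK //.
    by len_lia.
  have sm : ~~ ldesc s m.
    have /ldesc_wle/contra : wle m (g s * a0)%g by apply: m1; rewrite genK.
    by apply; rewrite ldesc_mul negbK.
  exists (g s * m)%g; split=> [a Aa||u lu su].
  - rewrite -[a](genK s) wle_mulgl //; first by apply: m1; rewrite genK.
    by rewrite ldesc_mul negbK; apply: Ds.
  - by rewrite ldesc_mul.
  - rewrite -[u](genK s) wle_mulgl //; last by rewrite ldesc_mul negbK.
    apply: m2 => v Ay; rewrite -(genK s v) wle_mulgl_desc //; last exact: Ds.
    exact: lu.
have best_desc s t m : D s -> D t -> (forall u, lower u -> ldesc s u -> wle u m) -> ldesc t m.
  (* The component z of [a0] in W_{s,t} is a lower bound above both s and t: elements with left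
     descents s and t have every positive root of that plane as an inversion. *)
  move=> Ds Dt mm; have [z zK hz] := par_proj [set s; t] a0.
  have zdesc r : r \in [set s; t] -> D r -> ldesc r z.
    move=> rK Dr; apply/ldescP/hz; split; last exact: supported_basis.
    exact/ldescP/Dr.
  apply: (@ldesc_wle _ z); last by apply: zdesc; rewrite ?inE ?eqxx ?orbT.
  apply: mm; last by apply: zdesc; rewrite ?inE ?eqxx.
  move=> a Aa; apply/weak_leP => x /[dup] zx /hz [_ xK].
  by apply: inv_pair xK; [exact: Ds | exact: Dt | exact: zx.1].
case: (classic (exists s, D s)) => [[s Ds]|nD]; last first.
  exists 1%g; split=> [a _|u lu]; first exact: wle1.
  have [->|/exists_ldesc[s su]] := eqVneq u 1%g; first exact: wle1.
  by case: nD; exists s; apply: lowerD su.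
have [m [lm sm mm]] := best s Ds; exists m; split=> // u lu.
have [->|/exists_ldesc[t tu]] := eqVneq u 1%g; first exact: wle1.
have Dt := lowerD _ _ lu tu; have [m' [lm' tm' mm']] := best t Dt.
apply: (wle_trans (mm' u lu tu)); apply: mm => //.
exact: best_desc Dt Ds mm'.
Qed.

End WeakOrder.

(** * Orientations and aligned elements *)

Section Aligned.

Variables (W : groupType) (C : coxeterSystem W).
Local Notation S := (simple_refl C).
Local Notation V := (vect S).
Local Notation g := (@gen W C).
Local Notation e := (@basis S).
Local Notation len := (@cox_length W C).
Local Notation wle := (@weak_le W C).
Local Notation in_par := (@in_par W C).
Implicit Types (s t r : S) (u v w : W) (p q : seq S) (x y z : V) (J K : {set S}).
Implicit Types (Om : rel S).

Lemma edge_sym s t : diagram_edge s t = diagram_edge t s.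
Proof. by rewrite /diagram_edge eq_sym [_ == (g t * g s)%g]eq_sym. Qed.

Lemma orient_coef Om s t : orientation Om -> Om s t -> 1 <= coef s t.
Proof. by move=> [h _] /h /andP[st]; exact: coef_noncommute. Qed.

Lemma orient_neq Om s t : orientation Om -> Om s t -> s != t.
Proof. by move=> [h _] /h /andP[]. Qed.

Lemma orient_irr Om s : orientation Om -> Om s s = false.
Proof. by move=> oO; apply/negP => /(orient_neq oO); rewrite eqxx. Qed.

Lemma orient_asym Om s t : orientation Om -> Om s t -> ~~ Om t s.
Proof. by move=> [h1 h2] st; have := h2 s t (h1 s t st); rewrite st. Qed.

Lemma orient_coef0 Om s t : orientation Om -> s != t -> ~~ Om s t -> ~~ Om t s -> coef s t = 0.
Proof.
move=> [_ h] st nst nts; apply: coef_commute => //; apply/eqP; apply: contraT => st'.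
by have := h s t; rewrite /diagram_edge st st' (negPf nst) (negPf nts) => /(_ isT).
Qed.

Lemma orient_commute Om s t : orientation Om -> ~~ Om s t -> ~~ Om t s -> (g s * g t = g t * g s)%g.
Proof.
move=> [_ h] nst nts; have [->//|st] := eqVneq s t; apply/eqP; apply: contraT => st'.
by have := h s t; rewrite /diagram_edge st st' (negPf nst) (negPf nts) => /(_ isT).
Qed.

(** Reversing at the vertices of A one after the other has this effect: an edge inside A is reversed
    twice, an edge leaving A once. *)
Definition flip (A : {set S}) Om : rel S :=
  fun s t => if (s \in A) (+) (t \in A) then Om t s else Om s t.

Lemma flip_orientation A Om : orientation Om -> orientation (flip A Om).
Proof.
move=> [h1 h2]; rewrite /flip; split=> s t.
  by case: ifP => _ /h1 //; rewrite edge_sym.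
by rewrite [(t \in A) (+) _]addbC => /h2; case: ifP => // _; rewrite addbC.
Qed.

Definition sink Om J s := s \in J /\ forall t, t \in J -> ~~ Om s t.

(** Equivalent to the absence of directed cycles by [acyclicP]; this form supports induction by
    removal of sinks. *)
Definition acyc Om J := forall K, K \subset J -> K != set0 -> exists s, sink Om K s.

Lemma acycS Om J K : K \subset J -> acyc Om J -> acyc Om K.
Proof. by move=> KJ aJ L LK; apply: aJ; apply: subset_trans KJ. Qed.

Lemma sinkS Om J K s : K \subset J -> s \in K -> sink Om J s -> sink Om K s.
Proof. by move=> /subsetP KJ sK [_ h]; split=> // t /KJ/h. Qed.

Lemma acyc_flip Om J s : acyc Om J -> sink Om J s -> acyc (flip [set s] Om) J.
Proof.
move=> aJ [sJ hs] K KJ K0; have sK t : t \in K -> t \in J by apply/subsetP.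
have [Ks|Ks] := eqVneq (K :\ s) set0.
  exists s; have inK t : t \in K -> t = s.
    by move=> tK; apply/eqP; move/setP: Ks => /(_ t); rewrite !inE tK andbT => /negbFE.
  have [t tK] := set0Pn _ K0; have ts := inK t tK.
  split=> [|t' /[dup] t'K /inK ->]; first by rewrite -ts.
  by rewrite /flip addbb; apply: hs.
have [||t [tK ht]] := aJ (K :\ s) => //; first exact: subset_trans (subsetDl _ _) KJ.
move: tK; rewrite !inE => /andP[ts tK]; exists t; split=> // r rK.
rewrite /flip !inE (negPf ts) /=; have [->|rs] := eqVneq r s; first exact/hs/sK.
by apply: ht; rewrite !inE rs.
Qed.

(* For an acyclic orientation with Coxeter element c this is the skew-symmetric
   form omega_c of Reading and Speyer; om (e s) (e t) > 0 for an edge t -> s. *)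
Definition om Om x y : F :=
  \sum_s \sum_t ((Om t s)%:R - (Om s t)%:R) * coef s t * x s * y t.

Lemma omC Om x y : om Om y x = - om Om x y.
Proof.
rewrite /om exchange_big -sumrN; apply: eq_bigr => s _; rewrite -sumrN.
by apply: eq_bigr => t _; rewrite (coefC t s); ring.
Qed.

Lemma omDl Om x y z : om Om (x + y) z = om Om x z + om Om y z.
Proof.
rewrite /om -big_split; apply: eq_bigr => s _; rewrite -big_split.
by apply: eq_bigr => t _; rewrite vE /=; ring.
Qed.

Lemma omZl Om c x y : om Om (c *: x) y = c * om Om x y.
Proof.
rewrite /om mulr_sumr; apply: eq_bigr => s _; rewrite mulr_sumr.
by apply: eq_bigr => t _; rewrite vE; ring.
Qed.

Lemma omDr Om x y z : om Om x (y + z) = om Om x y + om Om x z.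
Proof. by rewrite omC omDl !(omC _ x) opprD !opprK. Qed.

Lemma omZr Om c x y : om Om x (c *: y) = c * om Om x y.
Proof. by rewrite omC omZl (omC _ x) mulrN opprK. Qed.

Lemma omxx Om x : om Om x x = 0.
Proof. by have := omC Om x x; lra. Qed.

Lemma om_agree Om Om' J x y : (forall s t, s \in J -> t \in J -> Om s t = Om' s t) ->
  supported J x -> supported J y -> om Om x y = om Om' x y.
Proof.
move=> h xJ yJ; apply: eq_bigr => s _; apply: eq_bigr => t _.
case: (boolP (s \in J)) => [sJ|/xJ ->]; last by rewrite !mulr0 !mul0r.
case: (boolP (t \in J)) => [tJ|/yJ ->]; last by rewrite !mulr0.
by rewrite !h.
Qed.

(** Reversal at s negates exactly the terms with one index equal to s, which amounts to changing the
    sign of the coordinate at s in both arguments. *)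
Lemma om_flip Om s x y : orientation Om ->
  om (flip [set s] Om) x y = om Om (x - (2 * x s) *: e s) (y - (2 * y s) *: e s).
Proof.
move=> oO; apply: eq_bigr => i _; apply: eq_bigr => j _.
rewrite /flip !inE !vE !basisE.
have [->|si] := eqVneq i s; have [->|sj] := eqVneq j s; rewrite ?eqxx ?(negPf si) ?(negPf sj) /=.
- by rewrite orient_irr //=; ring.
- ring.
- ring.
- ring.
Qed.

(** The contribution of the neighbours of s to [lam s y]. It controls signs: it is nonnegative on
    nonnegative y, and it is omega(e_s, y) when s is a sink and the opposite when s has become a
    source. *)
Definition nsum s y : F := lam s y + 2 * y s.

Lemma nsumE s y : nsum s y = \sum_(t | t != s) coef s t * y t.
Proof. by rewrite /nsum /lam (bigD1 s) //= coefss; ring. Qed.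

Lemma nsum_ge0 s y : nonneg y -> 0 <= nsum s y.
Proof.
by move=> y0; rewrite nsumE; apply: sumr_ge0 => t ts; rewrite mulr_ge0 // coef_ge0 // eq_sym.
Qed.

Lemma om_sink Om J s y : orientation Om -> sink Om J s -> supported J y ->
  om Om (e s) y = nsum s y.
Proof.
move=> oO [sJ hs] yJ; rewrite nsumE /om (bigD1 s) //= [X in _ + X]big1 ?addr0; last first.
  by move=> i si; apply: big1 => t _; rewrite basisE (negPf si) mulr0 mul0r.
rewrite (bigD1 s) //= orient_irr // subrr !mul0r add0r; apply: eq_bigr => t ts.
rewrite basisE eqxx mulr1; case: (boolP (t \in J)) => [tJ|/yJ ->]; last by rewrite !mulr0.
rewrite (negPf (hs t tJ)) subr0; case: (boolP (Om t s)) => h; first by rewrite mul1r.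
by rewrite [coef s t](@orient_coef0 Om) ?hs // 1?eq_sym // !mulr0.
Qed.

(** After the sign change of [om_flip], the reflection becomes z - n(z) e_s, with n = [nsum s]. As
    omega(e_s, z) = n(z) at a sink, the two correction terms cancel. *)
Lemma om_refl Om J s x y : orientation Om -> sink Om J s -> supported J x -> supported J y ->
  om (flip [set s] Om) (refl s x) (refl s y) = om Om x y.
Proof.
move=> oO sJ xJ yJ; rewrite om_flip //.
have e1 z : refl s z - (2 * refl s z s) *: e s = z + - nsum s z *: e s.
  by apply/ffunP => t; rewrite /refl /nsum !vE !basisE eqxx /=; ring.
rewrite !e1 !(omDl, omDr, omZl, omZr) omxx (om_sink oO sJ yJ) (omC _ (e s) x) (om_sink oO sJ xJ).
ring.
Qed.

Lemma om_source Om J s y : orientation Om -> sink Om J s -> supported J y ->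
  om (flip [set s] Om) (e s) y = - nsum s y.
Proof.
move=> oO sJ yJ; rewrite om_flip // -(om_sink oO sJ yJ).
have -> : e s - (2 * e s s) *: e s = - 1 *: e s.
  by apply/ffunP => t; rewrite !vE !basisE eqxx /=; ring.
by rewrite omZl omDr -scaleNr omZr omxx; ring.
Qed.

(* In the language of quiver representations, b1 and b2 are the classes of a
   subobject and a quotient of an object of class c. *)
Definition aligned Om w := forall a b b1 b2 c, pos_root b1 -> pos_root b2 -> inv w c ->
  0 < a -> 0 < b -> c = a *: b1 + b *: b2 -> 0 < om Om b1 b2 -> inv w b1.

Lemma aligned_agree Om Om' J w : (forall s t, s \in J -> t \in J -> Om s t = Om' s t) ->
  in_par J w -> aligned Om w -> aligned Om' w.
Proof.
move=> h wJ al a b b1 b2 c p1 p2 ic a0 b0 cE.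
have := inv_par wJ ic; rewrite cE => /(supported_comb a0 b0 p1.2 p2.2)[J1 J2].
by rewrite -(om_agree h) //; exact: (al a b b1 b2 c p1 p2 ic a0 b0 cE).
Qed.

Lemma aligned_proj Om J u w : (forall x, inv u x <-> inv w x /\ supported J x) ->
  aligned Om w -> aligned Om u.
Proof.
move=> hu al a b b1 b2 c p1 p2 /hu[wc cJ] a0 b0 cE h.
have [J1 _] : supported J b1 /\ supported J b2.
  by apply: supported_comb a0 b0 p1.2 p2.2 _; rewrite -cE.
by apply/hu; split=> //; apply: (al a b b1 b2 c).
Qed.

Lemma aligned1 Om : aligned Om 1%g.
Proof. by move=> a b b1 b2 c _ _ /inv1. Qed.

Lemma pos_root_supp1 s x : pos_root x -> supported [set s] x -> x = e s.
Proof.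
move=> px xs; have ix : inv (g s) x.
  apply: (@inv_pair _ _ _ s s); rewrite ?setUid //; try by rewrite /ldesc gen_sq len1 len_gen.
rewrite -[g s]mulg1 in ix; move/(inv_mulgl): ix => [||/inv1 //] //.
by rewrite /ldesc mulg1 len_gen len1.
Qed.

Lemma inv_refl s w x : ldesc s w -> x <> e s -> inv w x <-> inv (g s * w)%g (refl s x).
Proof.
move=> sw xs; split=> [/(inv_mulgl_desc _ sw)[]//|h].
by apply/(inv_mulgl_desc _ sw); right.
Qed.

Lemma refl_neq_basis s x : pos_root x -> refl s x <> e s.
Proof.
move=> px h; apply: (root_sign_excl px.1 px.2).
by rewrite -[x](reflK s) h refl_basis opprK; exact: nonneg_basis.
Qed.

(** By [om_refl] the reflection carries a triple (b1, b2, c) for one orientation to a triple for the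
    other, unless a root is [e s]. At the sink, b2 = [e s] has the wrong sign of omega and b1 =
    [e s] is an inversion because s is a descent; at the source, b1 = [e s] has the wrong sign, and
    b2 = [e s] needs an argument of its own. *)
Lemma aligned_desc Om J s w : orientation Om -> sink Om J s -> in_par J w -> ldesc s w ->
  aligned Om w <-> aligned (flip [set s] Om) (g s * w)%g.
Proof.
move=> oO sJ wJ sw; have swJ : in_par J (g s * w)%g by apply: parM => //; apply/par_gen/sJ.1.
split=> al a b b1 b2 c p1 p2 ic a0 b0 cE h.
  have := inv_par swJ ic; rewrite cE => /(supported_comb a0 b0 p1.2 p2.2)[J1 J2].
  have n1 : b1 <> e s.
    move=> b1s; move: h; rewrite b1s (om_source oO sJ J2) oppr_gt0 ltNge.
    by rewrite nsum_ge0 //; exact: p2.2.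
  have ns : ~~ ldesc s (g s * w)%g by rewrite ldesc_mul negbK.
  have nc : c <> e s by move=> ce; move/negP: ns; apply; apply/ldescP; rewrite -ce.
  have ic' : inv w (refl s c) by apply/(inv_mulgl_desc _ sw); right; rewrite reflK.
  suff i1 : inv w (refl s b1).
    by have := (inv_refl sw (refl_neq_basis p1)).1 i1; rewrite reflK.
  have p1' := refl_pos p1 n1.
  have cE' : refl s c = a *: refl s b1 + b *: refl s b2 by rewrite cE reflD !reflZ.
  have [b2s|/eqP n2] := eqVneq b2 (e s); last first.
    apply: (al a b _ (refl s b2) (refl s c)) => //; first exact: refl_pos.
    rewrite -(om_refl oO sJ) ?reflK //; apply: supportedD => //; apply/supportedZ/supported_basis/sJ.1.
  (* For b2 = e_s the relation c = a b1 + b e_s becomes s b1 = (s c + b e_s) / a, a nonnegative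
     combination of two inversions of w. *)
  have /ldescP is_ := sw.
  apply: (inv_comb p1' _ _ ic' is_ (a := a^-1) (b := b / a)).
  - by rewrite invr_ge0 ltW.
  - by rewrite divr_ge0 ?ltW.
  rewrite cE' b2s refl_basis scalerDr !scalerA mulVf ?gt_eqF // scale1r scalerN.
  by rewrite [a^-1 * b]mulrC subrK.
have := inv_par wJ ic; rewrite cE => /(supported_comb a0 b0 p1.2 p2.2)[J1 J2].
have [->|/eqP n1] := eqVneq b1 (e s); first exact/ldescP.
have [b2s|/eqP n2] := eqVneq b2 (e s).
  move: h; rewrite b2s omC (om_sink oO sJ J1) oppr_gt0 ltNge nsum_ge0 //; exact: p1.2.
have nc : c <> e s.
  move=> ce; apply: n1; apply: pos_root_supp1 => //.
  have : supported [set s] c by rewrite ce; apply: supported_basis; rewrite inE.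
  by rewrite cE => /(supported_comb a0 b0 p1.2 p2.2)[].
apply/(inv_refl sw n1); apply: (al a b _ (refl s b2) (refl s c)) => //.
- exact: refl_pos.
- exact: refl_pos.
- exact/(inv_refl sw nc).
- by rewrite cE reflD !reflZ.
- by rewrite (om_refl oO sJ).
Qed.

End Aligned.

(** * Aligned elements at a sink; their joins and meets *)

Section AlignedLattice.

Variables (W : groupType) (C : coxeterSystem W).
Local Notation S := (simple_refl C).
Local Notation V := (vect S).
Local Notation g := (@gen W C).
Local Notation e := (@basis S).
Local Notation len := (@cox_length W C).
Local Notation wle := (@weak_le W C).
Local Notation in_par := (@in_par W C).
Implicit Types (s t r : S) (u v w : W) (p q : seq S) (x y z : V) (J K : {set S}).
Implicit Types (Om : rel S).

Lemma par_red J w : in_par J w -> exists p, [/\ all (mem J) p, word_prod g p = w & size p = len w].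
Proof.
have [n] := ubnP (len w); elim: n w => // n IH w wn wJ.
have [->|w1] := eqVneq w 1%g; first by exists [::]; rewrite word_prod_nil len1.
have [s sw] := exists_ldesc C w1; have lw := len_ldesc sw; have sJ := par_ldesc wJ sw.
have [||p [pJ pw sp]] := IH (g s * w)%g; first by len_lia.
  by apply: parM => //; apply: par_gen.
exists (s :: p); split; first by rewrite /= pJ andbT.
  by rewrite word_prod_cons pw genK.
by rewrite /= sp lw.
Qed.

(** Telescoping over the letters of p. It is stated through a linear functional so that it can be
    read under omega, under the bilinear form and in each coordinate. *)
Lemma act_word_basis (f : V -> F) s p :
  (forall x y, f (x + y) = f x + f y) -> (forall c x, f (c *: x) = c * f x) ->
  f (act (word_prod g p) (e s)) = f (e s) +
    \sum_(j < size p) coef s (nth s p j) * f (act (word_prod g (take j p)) (e (nth s p j))).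
Proof.
move=> fD fZ; elim/last_ind: p => [|p r IH].
  by rewrite word_prod_nil act1 big_ord0 addr0.
rewrite size_rcons big_ord_recr /= -cats1 word_prod_cat word_prod1 actM act_gen.
rewrite /refl lam_basis actD actZ fD fZ IH -addrA (coefC r s); congr (_ + (_ + _)).
  by apply: eq_bigr => j _; rewrite nth_cat takel_cat ?ltn_ord // ltnW.
by rewrite nth_cat ltnn subnn take_size_cat.
Qed.

Lemma act_par_coef J s u : in_par (J :\ s) u -> act u (e s) s = 1.
Proof. by move=> uJ; rewrite (act_par_out _ uJ) ?basisE ?eqxx // !inE eqxx. Qed.

Lemma act_par_pos J s u : in_par (J :\ s) u -> pos_root (act u (e s)).
Proof.
move=> uJ; have rs := root_act u (root_basis s); split=> //.
case: (root_sign rs) => // /(_ s); rewrite vNE (act_par_coef uJ) oppr_ge0.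
by rewrite leNgt ltr01.
Qed.

(* Among the u in W_(J - s) such that u e_s is an inversion of w take one of
   minimal length. Every reflection t_b in an inversion b of u then satisfies
   om (u e_s) b <= 0, since otherwise alignment makes t_b u a shorter choice.
   Expanding u e_s = e_s + \sum_j coef s p_j * b_j inside om (u e_s) (u e_s) = 0
   and bil (u e_s) (u e_s) = 2 forces u = 1. *)
Lemma aligned_sink_inv Om J s w u : orientation Om -> sink Om J s -> in_par J w ->
  aligned Om w -> in_par (J :\ s) u -> inv w (act u (e s)) -> inv w (e s).
Proof.
move=> oO sJ wJ al; have [n] := ubnP (len u); elim: n u => // n IH u un uJ iu.
apply: NNPP => ns; have IHu v : (len v < len u)%N -> in_par (J :\ s) v -> ~ inv w (act v (e s)).
  by move=> vu vJ /IH h; apply/ns/h => //; len_lia.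
have [p [pJ pu sp]] := par_red uJ.
set c := act u (e s) in iu; have cs : c s = 1 := act_par_coef uJ.
have cJ : supported J c := inv_par wJ iu.
have c0 : nonneg c by case: iu => -[].
pose b (j : nat) := act (word_prod g (take j p)) (e (nth s p j)).
have bP (j : 'I_(size p)) :
    [/\ 0 <= coef s (nth s p j), om Om c (b j) <= 0 & 0 < bil c (b j)].
  set r := nth s p j; have rJ : r \in J :\ s by apply: (allP pJ); rewrite mem_nth.
  set v := word_prod g (take j p); pose v' := word_prod g (drop j.+1 p).
  have vJ : in_par (J :\ s) v.
    by exists (take j p) => //; apply/allP => t /mem_take/(allP pJ).
  have v'J : in_par (J :\ s) v'.
    by exists (drop j.+1 p) => //; apply/allP => t /mem_drop/(allP pJ).
  have uE : u = (v * g r * v')%g.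
    by rewrite -mulgA -word_prod_cons -word_prod_cat -drop_nth // cat_take_drop.
  have lv : (len v <= j)%N by apply: leq_trans (len_word _) _; rewrite size_take_min geq_minl.
  have lv' : (len v' <= size p - j.+1)%N by apply: leq_trans (len_word _) _; rewrite size_drop.
  have jp := ltn_ord j.
  have l1 := lenM C (v * g r)%g v'; have l2 := lenM C v (g r * v')%g; have l3 := lenM C v v'.
  rewrite -uE in l1; rewrite mulgA -uE in l2.
  have up : (len v < len (v * g r)%g)%N by case: (len_mulg_gen v r) => h; len_lia.
  have up' : (len v'^-1%g < len (v'^-1 * g r)%g)%N.
    rewrite -[(g r)]genV -invgM !lenV; case: (len_gen_mulg r v') => h; len_lia.
  have bpos : pos_root (b j).
    by split; [apply/root_act/root_basis | apply: act_basis_nonneg].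
  (* Moving u across the form turns b_j into -v'^-1 e_r, which has coordinate 0 at s, so only the
     neighbours of s contribute. *)
  have bilE : bil c (b j) = nsum s (act v'^-1%g (e r)).
    rewrite /c /b -/v -/r bil_actl -actM uE !invgM -!mulgA mulVg mulg1 genV actM act_gen.
    rewrite refl_basis actN bilNr bil_basisl opprK /nsum.
    by rewrite (act_par_supported (parV v'J) (supported_basis rJ)) ?mulr0 ?addr0 // !inE eqxx.
  have bil0 : 0 <= bil c (b j).
    by rewrite bilE; apply/nsum_ge0/act_basis_nonneg.
  have vv'J := parM vJ v'J.
  have vv'E : act (v * v')%g (e s) = c - bil c (b j) *: b j.
    rewrite /b -/v -/r -act_reflection /c -actM uE; congr (act _ _).
    by rewrite -!mulgA mulKg genK.
  have short : (len (v * v')%g < len u)%N by len_lia.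
  split.
  - by apply: coef_ge0; move: rJ; rewrite !inE eq_sym => /andP[].
  - rewrite leNgt; apply/negP => h; case: (IHu _ short vv'J).
    have bil1 : 0 < bil c (b j).
      rewrite lt_def bil0 andbT; apply/eqP => b0; case: (IHu _ short vv'J).
      by rewrite vv'E b0 scale0r subr0.
    apply: (al 1 (bil c (b j)) _ (b j) c) => //; first exact: act_par_pos vv'J.
      by rewrite vv'E scale1r subrK.
    by rewrite vv'E omDl -scaleNr omZl omxx mulr0 addr0.
  - rewrite lt_def bil0 andbT; apply/eqP => b0; case: (IHu _ short vv'J).
    by rewrite vv'E b0 scale0r subr0.
have sumf f fD fZ := @act_word_basis f s p fD fZ.
rewrite pu -/c in sumf.
have := sumf (om Om c) (omDr Om c) (fun a => omZr Om a c).
rewrite omxx omC (om_sink oO sJ cJ) => om0.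
have := sumf (bil c) (bilDr c) (fun a => bilZr a c).
have -> : bil c c = 2 by case: iu => -[/root_bil].
rewrite bilC bil_basisl => bil0.
have le1 : \sum_(j < size p) coef s (nth s p j) * om Om c (b j) <= 0.
  by apply: sumr_le0 => j _; have [h1 h2 _] := bP j; rewrite mulr_ge0_le0.
(* In omega(c, c) = 0 the term at e_s is -n(c) and the others are nonpositive, so n(c) = 0. In bil c
   c = 2 the term at e_s is then 2 c_s = 2, so the nonnegative remaining terms vanish too. *)
have n0 : nsum s c = 0 by apply/le_anti; rewrite nsum_ge0 // andbT; move: om0 le1; rewrite /b; lra.
have sum0 : \sum_(j < size p) coef s (nth s p j) * bil c (b j) = 0.
  by move: n0 bil0; rewrite /nsum /b cs; lra.
have co0 (j : 'I_(size p)) : coef s (nth s p j) = 0.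
  have nn (i : 'I_(size p)) : true -> 0 <= coef s (nth s p i) * bil c (b i).
    by have [h1 _ /ltW h3] := bP i; rewrite mulr_ge0.
  have /eqP : coef s (nth s p j) * bil c (b j) = 0 := psumr_eq0P nn sum0 isT.
  rewrite mulf_eq0 => /orP[/eqP //|/eqP h].
  by have [_ _] := bP j; rewrite h ltxx.
case: ns; suff -> : e s = c by [].
apply/ffunP => t; have := sumf (fun x => x t) (fun x y => vDE x y t) (fun a x => vZE a x t).
by move=> ->; rewrite big1 ?addr0 // => j _; rewrite co0 mul0r.
Qed.

(** Write w = u v with u in W_{J - s} and v without left descents in J - s. If v is not 1, its only
    left descent is s, so u e_s is an inversion of w, and then [aligned_sink_inv] makes s a descent
    of w. *)
Lemma aligned_par Om J s w : orientation Om -> sink Om J s -> in_par J w ->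
  aligned Om w -> ~~ ldesc s w -> in_par (J :\ s) w.
Proof.
move=> oO sJ wJ al ns; have [u [v [wE uJ vJ]]] := par_decomp (J :\ s) w.
have [v1|/(exists_ldesc C)[r rv]] := eqVneq v 1%g; first by rewrite wE v1 mulg1.
have vE : v = (u^-1 * w)%g by rewrite wE mulKg.
have rJ : r \in J.
  apply: par_ldesc rv; rewrite vE; apply: parM => //; apply/parV; exact: parS (subsetDl _ _) uJ.
have rs : r = s.
  apply/eqP; apply: contraT => rs; have := vJ r; rewrite !inE rs rJ => /(_ isT).
  by rewrite rv.
case/ldescP: ns; apply: (aligned_sink_inv oO sJ wJ al uJ); split; first exact: act_par_pos uJ.
rewrite wE invgM actM actK -rs; by case/ldescP: rv.
Qed.

(** A substitute for the join: minimality is required only among upper bounds below j, so existence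
    follows from an upper bound and induction on length. *)
Definition min_upper (A : W -> Prop) j := (forall a, A a -> wle a j) /\
  forall u, wle u j -> (forall a, A a -> wle a u) -> u = j.

Lemma min_upper_exists (A : W -> Prop) j : (forall a, A a -> wle a j) ->
  exists2 u, wle u j & min_upper A u.
Proof.
have [n] := ubnP (len j); elim: n j => // n IH j jn Aj.
case: (classic (exists u, [/\ wle u j, u <> j & forall a, A a -> wle a u])) => [[u [uj nuj Au]]|h].
  have lu := wle_lt uj nuj; have [||v vu vA] := IH u => //; first by len_lia.
  by exists v => //; apply: wle_trans uj.
exists j; first exact: wle_refl.
by split=> // u uj Au; apply: NNPP => nuj; case: h; exists u.
Qed.

Lemma min_upper_par J (A : W -> Prop) j : (forall a, A a -> in_par J a) -> min_upper A j ->
  in_par J j.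
Proof.
move=> AJ [Aj jmin]; have [u uJ hu] := par_proj J j.
rewrite -(jmin u) //; first by apply/weak_leP => x /hu[].
move=> a Aa; apply/weak_leP => x ax; apply/hu; split.
  exact: ((weak_leP _ _ _).1 (Aj a Aa)).
exact: inv_par (AJ a Aa) ax.
Qed.

Lemma min_upper_mulgl s (A : W -> Prop) j : ldesc s j -> (forall a, A a -> ldesc s a) ->
  min_upper A j -> min_upper (fun a => A (g s * a)%g) (g s * j)%g.
Proof.
move=> sj sA [Aj jmin]; have nsj : ~~ ldesc s (g s * j)%g by rewrite ldesc_mul negbK.
have nsA a : A (g s * a)%g -> ~~ ldesc s a by move/sA; rewrite ldesc_mul.
split=> [a Aa|u uj Au].
  by rewrite -(genK s a) wle_mulgl_desc //; [apply: Aj | apply: sA].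
have nsu : ~~ ldesc s u by apply: contra nsj; apply: ldesc_wle.
rewrite -[LHS](genK s u) (jmin (g s * u)%g) //.
  by rewrite -[j](genK s j) wle_mulgl.
move=> a Aa; rewrite -[a](genK s a) wle_mulgl //; last by rewrite ldesc_mul negbK; apply: sA.
by apply: Au; rewrite genK.
Qed.

Lemma min_upper_incl (A B : W -> Prop) j : min_upper A j -> (forall a, A a -> exists2 b, B b & wle a b) ->
  (forall b, B b -> wle b j) -> min_upper B j.
Proof.
move=> [Aj jmin] AB Bj; split=> // u uj Bu; apply: jmin => // a /AB[b Bb ab].
exact: wle_trans ab (Bu b Bb).
Qed.

Definition pair_pred u v : W -> Prop := fun w => w = u \/ w = v.

Lemma wle_cover v j : wle v j -> v <> j ->
  exists r, [/\ (len v < len (v * g r)%g)%N, wle v (v * g r)%g & wle (v * g r)%g j].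
Proof.
move=> /eqP vj nvj; have z1 : (v^-1 * j)%g != 1%g.
  by apply/eqP => h; apply: nvj; apply: (mulgI v^-1%g); rewrite h mulVg.
have [r rz] := exists_ldesc C z1; have lz := len_ldesc rz; exists r.
have l1 := lenM C v (g r); rewrite len_gen in l1.
have l2 := lenM C (v * g r)%g (g r * (v^-1 * j))%g.
rewrite -!mulgA genK mulVKg in l2; split; first by len_lia.
  by rewrite /weak_le mulKg len_gen; apply/eqP; len_lia.
by rewrite /weak_le invgM genV -!mulgA; apply/eqP; len_lia.
Qed.

(* On a chain from a up to j the first element above s is an upper bound of
   both, hence is j, and its predecessor on the chain is s j. *)
Lemma min_upper_cover s a j : min_upper (pair_pred (g s) a) j -> ~~ ldesc s a ->
  exists v, [/\ (g s * v)%g = j, ~~ ldesc s v & forall y, inv v y <-> inv j y /\ y <> e s].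
Proof.
move=> [jA jmin] nsa; have aj : wle a j by apply: jA; right.
have sj : ldesc s j by rewrite -wle_gen; apply: jA; left.
have : exists v, [/\ wle a v, wle v j & ~~ ldesc s v] by exists a; rewrite wle_refl.
case=> v; have [n] := ubnP (len j - len v)%N; elim: n v => // n IH v vn [av vj nsv].
have nvj : v <> j by move=> h; move: nsv; rewrite h sj.
have [r [vr v_vr vrj]] := wle_cover vj nvj.
have lj := wle_len vrj.
case: (boolP (ldesc s (v * g r)%g)) => [svr|nsvr]; last first.
  by apply: (IH (v * g r)%g); [len_lia | split=> //; apply: wle_trans av _].
have jE : (v * g r)%g = j.
  apply: jmin => // a' [->|->]; first by rewrite wle_gen.
  exact: wle_trans av _.
have esE : e s = act v (e r).
  have /ldescP := sj; rewrite -jE => /(inv_mulgr _ vr)[/ldescP h|//].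
  by rewrite h in nsv.
exists v; split=> //.
  rewrite -jE -[(v * g r)%g](mulgVK v); congr (_ * _)%g; apply: (@act_faithful _ C) => y.
  by rewrite act_reflection -esE act_gen /refl bilC bil_basisl scaleNr opprK.
move=> y; rewrite -jE; split=> [vy|[/(inv_mulgr _ vr)[//|->]]]; last by rewrite esE.
split; first by apply/(inv_mulgr _ vr); left.
by move=> ys; move/negP: nsv; apply; apply/ldescP; rewrite -ys.
Qed.

Lemma aligned_pair Om s t w : in_par [set s; t] w -> ldesc s w -> ldesc t w -> aligned Om w.
Proof.
move=> wK sw tw a b b1 b2 c p1 p2 ic a0 b0 cE _.
have := inv_par wK ic; rewrite cE => /(supported_comb a0 b0 p1.2 p2.2)[J1 _].
exact: inv_pair J1.
Qed.

Lemma aligned_gen Om s : aligned Om (g s).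
Proof.
apply: (@aligned_pair _ s s); rewrite /ldesc ?gen_sq ?len1 ?len_gen //.
by apply: par_gen; rewrite !inE eqxx.
Qed.

Lemma aligned_flip_par Om J s w : in_par (J :\ s) w ->
  aligned Om w <-> aligned (flip [set s] Om) w.
Proof.
move=> wJ; split; apply: (aligned_agree _ wJ) => r t; rewrite !inE /flip !inE.
  by move=> /andP[/negPf-> _] /andP[/negPf-> _].
by move=> /andP[/negPf-> _] /andP[/negPf-> _].
Qed.

(* By induction on len j + #|J|; s is a sink of J. If s is not below j then J
   can be shrunk. Otherwise each a in A may be replaced by s \/ a; the only
   problematic case is s \/ a = j with a not above s. Then let t be a sink of
   J - s. If a is not above t, then J - t suffices; otherwise j is the join of
   a and s \/ t, both above t and aligned for the orientation reversed at s,
   so j is aligned for it; removing the inversion e_s preserves this. *)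
Theorem min_upper_aligned Om J (A : W -> Prop) j : orientation Om -> acyc Om J ->
  (forall a, A a -> in_par J a) -> (forall a, A a -> aligned Om a) ->
  min_upper A j -> aligned Om j.
Proof.
have [n] := ubnP (len j + #|J|)%N; elim: n Om J A j => // n IH Om J A j jn oO aJ AJ Aal jA.
have jJ := min_upper_par AJ jA.
have [J0|/(aJ J (subxx J))[s sJ]] := eqVneq J set0.
  by move: jJ; rewrite J0 => /par0 ->; exact: aligned1.
have cJs : #|J| = (#|J :\ s|).+1 by rewrite (cardsD1 s) sJ.1.
case: (boolP (ldesc s j)) => [sj|nsj]; last first.
  apply: (IH Om (J :\ s) A) => //; first by lia.
    exact: acycS (subsetDl _ _) aJ.
  move=> a Aa; apply: (aligned_par oO sJ (AJ a Aa) (Aal a Aa)).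
  by apply: contra nsj; apply: ldesc_wle; case: jA => + _; apply.
have lsj := len_ldesc sj.
have jup a : A a -> wle a j by case: jA => + _; apply.
have pair_al a v : A a -> wle v j -> min_upper (pair_pred (g s) a) v -> aligned Om v.
  move=> Aa qj qmin.
  have pJ b : pair_pred (g s) a b -> in_par J b.
    by case=> ->; [apply/par_gen/sJ.1 | exact: AJ].
  have pal b : pair_pred (g s) a b -> aligned Om b.
    by case=> ->; [exact: aligned_gen | exact: Aal].
  have qJ := min_upper_par pJ qmin.
  case: (boolP (ldesc s a)) => [sa|nsa].
    rewrite -(qmin.2 a); first exact: Aal.
      by apply: qmin.1; right.
    by move=> b [->|->]; [rewrite wle_gen | exact: wle_refl].
  have [qE|/eqP nq] := eqVneq v j; last first.
    by apply: (IH Om J _ v _ oO aJ pJ pal qmin); have := wle_lt qj nq; lia.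
  subst v; have aJs := aligned_par oO sJ (AJ a Aa) (Aal a Aa) nsa.
  have oO' := flip_orientation [set s] oO; have aJ' := acyc_flip aJ sJ.
  have [Js0|/(aJ _ (subsetDl _ _))[t tJs]] := eqVneq (J :\ s) set0.
    have a1 : a = 1%g by move: aJs; rewrite Js0 => /par0.
    rewrite -(qmin.2 (g s)); first exact: aligned_gen.
      by apply: qmin.1; left.
    by move=> b [->|->]; [exact: wle_refl | rewrite a1; exact: wle1].
  have [tJs1 _] := tJs; move: (tJs1); rewrite !inE => /andP[ts tJ].
  (* As s was a sink of J, an edge between s and t pointed to s; reversal at s turns it into an
     incoming edge of t. *)
  have tJ' : sink (flip [set s] Om) J t.
    split=> // r rJ; rewrite /flip !inE (negPf ts) /=.
    have [->|rs] := eqVneq r s; first by case: sJ => _; apply.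
    by case: tJs => _; apply; rewrite !inE rs.
  have cJt : #|J| = (#|J :\ t|).+1 by rewrite (cardsD1 t) tJ.
  case: (boolP (ldesc t a)) => [ta|nta]; last first.
    have aJst := aligned_par oO tJs aJs (Aal a Aa) nta.
    apply: (IH Om (J :\ t) _ j _ oO _ _ pal qmin); first by lia.
      exact: acycS (subsetDl _ _) aJ.
    move=> b [->|->]; first by apply: par_gen; rewrite !inE eq_sym ts sJ.1.
    by apply: parS aJst; apply/subsetP => r; rewrite !inE => /and3P[-> _ ->].
  have [x [xE nsx xinv]] := min_upper_cover qmin nsa.
  have {}xE : x = (g s * j)%g by rewrite -xE genK.
  have xJ : in_par J x by rewrite xE; apply: parM => //; apply/par_gen/sJ.1.
  suff jal' : aligned (flip [set s] Om) j.
    apply/(aligned_desc oO sJ jJ sj); rewrite -xE => k l b1 b2 c p1 p2 ic k0 l0 cE h.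
    have := inv_par xJ ic; rewrite cE => /(supported_comb k0 l0 p1.2 p2.2)[_ J2].
    apply/xinv; split; first by apply: (jal' k l b1 b2 c) => //; case/xinv: ic.
    move=> b1s; move: h; rewrite b1s (om_source oO sJ J2) oppr_gt0 ltNge.
    by rewrite nsum_ge0 //; exact: p2.2.
  have tj : ldesc t j := ldesc_wle (jup a Aa) ta.
  have [|z zj zmin] := @min_upper_exists (pair_pred (g s) (g t)) j.
    by move=> b [->|->]; rewrite wle_gen.
  have zK : in_par [set s; t] z.
    by apply: min_upper_par zmin => b [->|->]; apply: par_gen; rewrite !inE eqxx ?orbT.
  have sz : ldesc s z by rewrite -wle_gen; apply: zmin.1; left.
  have tz : ldesc t z by rewrite -wle_gen; apply: zmin.1; right.
  have zJ : in_par J z.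
    by apply: parS zK; apply/subsetP => r; rewrite !inE => /orP[]/eqP->; rewrite ?sJ.1.
  have jmin : min_upper (pair_pred z a) j.
    apply: min_upper_incl qmin _ _ => b [->|->] //; last by apply: jup.
      by exists z; [left | rewrite wle_gen].
    by exists a; [right | exact: wle_refl].
  have Bt b : pair_pred z a b -> ldesc t b by case=> ->.
  have BJ b : pair_pred z a b -> in_par J b by case=> -> //; exact: AJ.
  have Bal b : pair_pred z a b -> aligned (flip [set s] Om) b.
    by case=> ->; [exact: aligned_pair zK sz tz | by apply/(aligned_flip_par Om aJs); exact: Aal].
  apply/(aligned_desc oO' tJ' jJ tj).
  have ltj := len_ldesc tj.
  apply: (IH _ J _ (g t * j)%g _ _ _ _ _ (min_upper_mulgl tj Bt jmin)); first by lia.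
  - exact: flip_orientation.
  - exact: acyc_flip.
  - by move=> b /BJ bJ; rewrite -(genK t b); apply: parM bJ; apply: par_gen.
  - move=> b Bb; have := (aligned_desc oO' tJ' (BJ _ Bb) (Bt _ Bb)).1 (Bal _ Bb).
    by rewrite genK.
pose Q v := exists a, [/\ A a, wle v j & min_upper (pair_pred (g s) a) v].
have Qs v : Q v -> ldesc s v by case=> a [_ _ [h _]]; rewrite -wle_gen; apply: h; left.
have QJ v : Q v -> in_par J v by case=> a [_ qj _]; apply: par_le qj jJ.
have Qal v : Q v -> aligned Om v by case=> a [Aa qj qmin]; apply: pair_al qmin.
have Qmin : min_upper Q j.
  apply: min_upper_incl jA _ _ => [a Aa|v [a []//]].
  have [|v qj qmin] := @min_upper_exists (pair_pred (g s) a) j.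
    by move=> b [->|->]; [rewrite wle_gen | exact: jup].
  by exists v; [exists a | apply: qmin.1; right].
apply/(aligned_desc oO sJ jJ sj).
apply: (IH _ J _ (g s * j)%g _ _ _ _ _ (min_upper_mulgl sj Qs Qmin)); first by lia.
- exact: flip_orientation.
- exact: acyc_flip.
- by move=> b /QJ bJ; rewrite -(genK s b); apply: parM bJ; apply/par_gen/sJ.1.
- move=> b Qb; have := (aligned_desc oO sJ (QJ _ Qb) (Qs _ Qb)).1 (Qal _ Qb).
  by rewrite genK.
Qed.

Lemma is_join_min_upper (A : W -> Prop) j : is_join C A j -> min_upper A j.
Proof.
by move=> [Aj jmin]; split=> // u uj Au; apply: wle_anti uj _; apply: jmin.
Qed.

(** If the sink s is below all of A it is cancelled. Otherwise some element of A lies in W_{J - s}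
    by [aligned_par], hence so does the meet, and A may be replaced by its components there. *)
Theorem meet_aligned Om J (A : W -> Prop) m : orientation Om -> acyc Om J ->
  (exists a, A a) -> (forall a, A a -> in_par J a) -> (forall a, A a -> aligned Om a) ->
  is_meet C A m -> aligned Om m.
Proof.
move=> oO aJ [a0 Aa0]; have [n] := ubnP (len a0 + #|J|)%N.
elim: n Om J A m a0 Aa0 oO aJ => // n IH Om J A m a0 Aa0 oO aJ an AJ Aal [mA mmax].
have mJ : in_par J m := par_le (mA a0 Aa0) (AJ a0 Aa0).
have [J0|/(aJ J (subxx J))[s sJ]] := eqVneq J set0.
  by move: mJ; rewrite J0 => /par0 ->; exact: aligned1.
have cJs : #|J| = (#|J :\ s|).+1 by rewrite (cardsD1 s) sJ.1.
case: (classic (forall a, A a -> ldesc s a)) => [sA|nsA].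
  have sm : ldesc s m by rewrite -wle_gen; apply: mmax => a /sA; rewrite wle_gen.
  have nsA a : A (g s * a)%g -> ~~ ldesc s a by move/sA; rewrite ldesc_mul.
  have la0 := len_ldesc (sA _ Aa0).
  apply/(aligned_desc oO sJ mJ sm).
  apply: (IH _ J (fun a => A (g s * a)%g) _ (g s * a0)%g); rewrite ?genK //.
  - exact: flip_orientation.
  - exact: acyc_flip.
  - by lia.
  - by move=> a /AJ aJ'; rewrite -(genK s a); apply: parM aJ'; apply/par_gen/sJ.1.
  - move=> a Aa; have := (aligned_desc oO sJ (AJ _ Aa) (sA _ Aa)).1 (Aal _ Aa).
    by rewrite genK.
  split=> [a Aa|u Au].
    by rewrite -(genK s a) wle_mulgl_desc //; [apply: mA | apply: sA].
  have nsu : ~~ ldesc s u.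
    have /ldesc_wle/contra : wle u (g s * a0)%g by apply: Au; rewrite genK.
    by apply; rewrite ldesc_mul negbK; apply: sA.
  rewrite -[u](genK s u) wle_mulgl_desc ?ldesc_mul //; apply: mmax => a Aa.
  rewrite -[a](genK s a) wle_mulgl //; last by rewrite ldesc_mul negbK; apply: sA.
  by apply: Au; rewrite genK.
have [a1 [Aa1 nsa1]] : exists a, A a /\ ~~ ldesc s a.
  by apply: NNPP => h; apply: nsA => a Aa; apply: contraT => nsa; case: h; exists a.
have a1J := aligned_par oO sJ (AJ _ Aa1) (Aal _ Aa1) nsa1.
have mJs := par_le (mA _ Aa1) a1J.
pose B u := exists a, A a /\ forall x, inv u x <-> inv a x /\ supported (J :\ s) x.
have [b0 b0J b0inv] := par_proj (J :\ s) a0.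
have lb0 : (len b0 <= len a0)%N by apply: wle_len; apply/weak_leP => x /b0inv[].
apply: (IH Om (J :\ s) B m b0) => //; first by exists a0.
- exact: acycS (subsetDl _ _) aJ.
- lia.
- by move=> b [a [_ h]]; apply/in_parP => x /h[].
- by move=> b [a [Aa h]]; apply: aligned_proj h (Aal a Aa).
split=> [b [a [Aa h]]|u Bu].
  apply/weak_leP => x mx; apply/h; split; last exact: inv_par mx.
  exact: ((weak_leP _ _ _).1 (mA a Aa)).
apply: mmax => a Aa; have [b bJ binv] := par_proj (J :\ s) a.
apply: (@wle_trans _ _ _ b); first by apply: Bu; exists a.
by apply/weak_leP => x /binv[].
Qed.

End AlignedLattice.

(** * Coxeter elements of acyclic subsets *)

Section CoxeterElements.

Variables (W : groupType) (C : coxeterSystem W).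
Local Notation S := (simple_refl C).
Local Notation V := (vect S).
Local Notation g := (@gen W C).
Local Notation e := (@basis S).
Local Notation len := (@cox_length W C).
Local Notation wle := (@weak_le W C).
Local Notation in_par := (@in_par W C).
Variable Om : rel S.
Hypothesis oO : orientation Om.
Local Notation cox := (cox_elt Om).
Local Notation acyc := (acyc Om).
Local Notation sink := (sink Om).
Implicit Types (s t r : S) (u v w : W) (p q : seq S) (x y z : V) (I J K M U : {set S}).

Lemma acyc_sink J s : sink J s -> acyc (J :\ s) -> acyc J.
Proof.
move=> [sJ hs] aJ K KJ K0; case: (boolP (s \in K)) => [sK|sK].
  by exists s; split=> // t tK; apply/hs/(subsetP KJ).
by apply: aJ => //; rewrite subsetD1 KJ.
Qed.

(** On a nonempty K without sinks, choosing successors defines a self-map, and the periodic part of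
    one of its orbits is a simple directed cycle. *)
Lemma acyclicP J : reflect (acyc J) (acyclic Om J).
Proof.
apply: (iffP idP) => [/existsPn aJ K KJ K0|aJ]; last first.
  apply/existsPn => k; apply/existsPn => p; apply/negP => /andP[/andP[cp _] pJ].
  have [||s []] := aJ [set x in p].
  - by apply/subsetP => x; rewrite inE => /(allP pJ).
  - by apply/set0Pn; exists (thead p); rewrite inE mem_tnth.
  rewrite inE => sp /(_ (next p s)); rewrite inE mem_next => /(_ sp)/negP; apply.
  exact: next_cycle.
apply: NNPP => nsink.
have out s : s \in K -> exists2 t, t \in K & Om s t.
  move=> sK; apply: NNPP => h; apply: nsink; exists s; split=> // t tK.
  by apply/negP => st; apply: h; exists t.
pose f s := odflt s [pick t in K | Om s t].
have fP s : s \in K -> (f s \in K) && Om s (f s).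
  rewrite /f => /out[t tK st]; case: pickP => [t' /andP[-> ->]//|/(_ t)].
  by rewrite /= tK st.
have [x xK] := set0Pn _ K0.
have iK i : iter i f x \in K by elim: i => //= i /fP/andP[].
have := looping_order f x; rewrite /looping => /trajectP[i io ie].
set y := iter i f x in ie; have yK : y \in K := iK i.
have [k kE] : exists k, order f x = (i + k.+1)%N.
  by exists (order f x - i).-1; rewrite prednK ?subn_gt0 // subnKC // ltnW.
have yE : iter k.+1 f y = y by rewrite /y -iterD addnC -kE ie.
have dy : drop i (orbit f x) = traject f y k.+1.
  rewrite /orbit kE; rewrite /y; elim: i x {io ie y yK kE yE iK xK} => [|i IH] x.
    by rewrite drop0 add0n.
  by rewrite addSn trajectS /= IH -iterSr.
have uy : uniq (traject f y k.+1) by rewrite -dy drop_uniq // orbit_uniq.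
have kS : (k < #|S|)%N.
  apply: leq_trans (max_card (fconnect f x)); rewrite -/(order f x) kE; lia.
have ally : all [in J] (traject f y k.+1).
  by apply/allP => z /trajectP[j _ ->]; rewrite /y -iterD; apply/(subsetP KJ)/iK.
have sy : size (traject f y k.+1) == k.+1 by rewrite size_traject.
have := aJ (Ordinal kS); rewrite negb_exists => /forallP/(_ (Tuple sy))/negP; apply.
apply/andP; split; last exact: ally; apply/andP; split; last exact: uy.
change (cycle Om (traject f y k.+1)).
rewrite trajectS /= (_ : rcons _ y = traject f (f y) k.+1); last by rewrite trajectSr -iterSr yE.
have ofpath q s : all [in K] (s :: q) -> fpath f s q -> path Om s q.
  elim: q s => //= t q IH s /andP[sK qK] /andP[/eqP st tq].
  by rewrite -{1}st (andP (fP s sK)).2; apply: IH.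
apply: ofpath; last exact: fpath_traject.
by apply/allP => z; rewrite -trajectS => /trajectP[j _ ->]; rewrite /y -iterD; apply: iK.
Qed.

Definition cword J p := [/\ uniq p, p =i J & pairwise (fun s t => ~~ Om s t) p].

Lemma compatible_pairwise p : uniq p -> compatible Om p = pairwise (fun s t => ~~ Om s t) p.
Proof.
move=> up; case: p up => // x0 p0; set p := x0 :: p0 => up.
apply/allrelP/(pairwiseP x0) => [h i j ip jp ij|h s t sp tp].
  apply/negP => hij; have := h (nth x0 p j) (nth x0 p i).
  rewrite !mem_nth // hij !index_uniq // => /(_ isT isT); rewrite ltnNge ltnW //.
apply/implyP => ts; rewrite ltnNge leq_eqVlt; apply/negP => /orP[/eqP ij|ij].
  by move: (orient_irr s oO); rewrite -{1}(nth_index x0 tp) in ts * ; rewrite ij nth_index // in ts; rewrite ts.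
have := h (index t p) (index s p); rewrite !inE !index_mem => /(_ tp sp ij).
by rewrite !nth_index // ts.
Qed.

Lemma cword_nil p : cword set0 p -> p = [::].
Proof. by case: p => // s p [_ /(_ s)]; rewrite !inE eqxx. Qed.

Lemma cword_cons J s p : sink J s -> cword (J :\ s) p -> cword J (s :: p).
Proof.
move=> [sJ hs] [up pJ pp]; split.
- by rewrite /= up pJ !inE eqxx.
- by move=> t; rewrite inE pJ !inE; case: eqVneq => // ->.
- by rewrite pairwise_cons pp andbT; apply/allP => t; rewrite pJ !inE => /andP[_ /hs].
Qed.

Lemma cword_exists J : acyc J -> exists p, cword J p.
Proof.
have [n] := ubnP #|J|; elim: n J => // n IH J Jn aJ.
have [->|/(aJ _ (subxx J))[s sJ]] := eqVneq J set0; first by exists [::]; split=> // s; rewrite inE.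
have [||p pJ] := IH (J :\ s); first by move: Jn; rewrite (cardsD1 s) sJ.1.
  exact: acycS (subsetDl _ _) aJ.
by exists (s :: p); apply: cword_cons.
Qed.

(** The sink s has no edge to or from the letters preceding it, hence commutes with them and can be
    moved to the front. *)
Lemma cword_sink J s p : cword J p -> sink J s ->
  exists2 q, cword (J :\ s) q & word_prod g p = (g s * word_prod g q)%g.
Proof.
move=> [up pJ pp] [sJ hs]; have sp : s \in p by rewrite pJ.
case/splitPr: sp up pJ pp => q1 q2 up pJ pp; exists (q1 ++ q2).
  have ss : subseq (q1 ++ q2) (q1 ++ s :: q2) by rewrite cat_subseq // subseq_cons.
  split; first exact: subseq_uniq ss up.
    move=> t; move: (pJ t); rewrite !inE !mem_cat inE => <-; move: up.
    rewrite cat_uniq /= => /and3P[_ /norP[s1 _] /andP[s2 _]].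
    by case: eqVneq => //= ->; rewrite (negPf s1) (negPf s2).
  exact: subseq_pairwise ss pp.
have comm t : t \in q1 -> (g t * g s = g s * g t)%g.
  move=> tq; apply: (orient_commute oO); last by apply: hs; rewrite -pJ mem_cat tq.
  move: pp; rewrite pairwise_cat => /and3P[/allrelP + _ _]; apply=> //; exact: mem_head.
rewrite !word_prod_cat word_prod_cons !mulgA; congr (_ * _)%g.
elim: q1 comm {up pJ pp} => [|t q1 IH] comm; first by rewrite word_prod_nil mul1g mulg1.
rewrite word_prod_cons -mulgA IH; last by move=> r rq; apply: comm; rewrite inE rq orbT.
by rewrite !mulgA comm ?mem_head.
Qed.

Lemma cword_prod J p q : cword J p -> cword J q -> word_prod g p = word_prod g q.
Proof.
elim: p J q => [|s p IH] J q pJ qJ.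
  have J0 : J = set0 by case: pJ => _ h _; apply/setP => t; rewrite -h inE.
  by rewrite J0 in qJ; rewrite (cword_nil qJ).
case: pJ => /andP[sp up] pJ /andP[/allP ps pp].
have sJ : sink J s.
  split=> [|t]; first by rewrite -pJ mem_head.
  rewrite -pJ inE => /orP[/eqP->|/ps //]; by rewrite (orient_irr s oO).
have [q' q'J ->] := cword_sink qJ sJ; rewrite word_prod_cons (IH (J :\ s) q') //.
split=> // t; rewrite !inE -pJ inE; case: eqVneq => //= ->; exact/negbTE.
Qed.

Lemma cox_cword J : acyc J -> exists2 p, cword J p & cox J = word_prod g p.
Proof.
move=> aJ; rewrite /cox_elt; set l := filter _ _.
have lP p : p \in l -> cword J p.
  rewrite mem_filter mem_permutations => /andP[cp pJ].
  have up : uniq p by rewrite (perm_uniq pJ) enum_uniq.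
  split=> //; first by move=> t; rewrite (perm_mem pJ) mem_enum.
  by rewrite -compatible_pairwise.
have [p [up pJ pp]] := cword_exists aJ.
have pl : p \in l.
  rewrite mem_filter compatible_pairwise // pp mem_permutations.
  by apply: uniq_perm => //; [exact: enum_uniq | move=> t; rewrite mem_enum pJ].
exists (head [::] l) => //; apply: lP; case: l pl => //= q l _; exact: mem_head.
Qed.

Lemma cox_sink J s : acyc J -> sink J s -> cox J = (g s * cox (J :\ s))%g.
Proof.
move=> aJ sJ; have [p pJ ->] := cox_cword aJ.
have [|q qJ ->] := @cox_cword (J :\ s); first exact: acycS (subsetDl _ _) aJ.
by rewrite -word_prod_cons; apply: cword_prod pJ _; apply: cword_cons.
Qed.

Lemma acyc0 : acyc set0.
Proof. by move=> K; rewrite subset0 => /eqP -> /eqP. Qed.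

Lemma cox0 : cox set0 = 1%g.
Proof. by have [p /cword_nil -> ->] := cox_cword acyc0; rewrite word_prod_nil. Qed.

Lemma cox_par J : acyc J -> in_par J (cox J).
Proof.
by move=> /cox_cword[p [_ pJ _] ->]; exists p => //; apply/allP => t; rewrite pJ.
Qed.

Lemma cox_sink_nldesc J s : acyc J -> ~~ ldesc s (cox (J :\ s)).
Proof.
move=> aJ; apply/negP => /(par_ldesc (cox_par (acycS (subsetDl _ _) aJ))).
by rewrite !inE eqxx.
Qed.

Lemma cox_sink_ldesc J s : acyc J -> sink J s -> ldesc s (cox J).
Proof. by move=> aJ sJ; rewrite (cox_sink aJ sJ) ldesc_mul cox_sink_nldesc. Qed.

Lemma acyc_ind (P : {set S} -> Prop) : P set0 ->
  (forall J s, acyc J -> sink J s -> P (J :\ s) -> P J) -> forall J, acyc J -> P J.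
Proof.
move=> P0 PS J; have [n] := ubnP #|J|; elim: n J => // n IH J Jn aJ.
have [->//|/(aJ _ (subxx J))[s sJ]] := eqVneq J set0.
apply: (PS J s) => //; apply: IH; last exact: acycS (subsetDl _ _) aJ.
by move: Jn; rewrite (cardsD1 s) sJ.1.
Qed.

Lemma len_cox J : acyc J -> len (cox J) = #|J|.
Proof.
elim/acyc_ind: J / => [|J s aJ sJ IH]; first by rewrite cox0 len1 cards0.
by rewrite (cox_sink aJ sJ) len_nldesc ?cox_sink_nldesc // IH (cardsD1 s J) sJ.1.
Qed.

Lemma cox_sink_wle J s w : acyc J -> sink J s -> ldesc s w ->
  wle (cox J) w = wle (cox (J :\ s)) (g s * w)%g.
Proof.
move=> aJ sJ sw; rewrite (cox_sink aJ sJ) -{1}(genK s w) wle_mulgl ?cox_sink_nldesc //.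
by rewrite ldesc_mul negbK.
Qed.

(* Since s is not in K, reflecting a root supported in K adds to it a
   nonnegative multiple of e_s. *)
Lemma wle_mulgl_par s K u w : in_par K u -> s \notin K -> ldesc s w -> wle u w ->
  wle u (g s * w)%g.
Proof.
move=> uK sK sw /weak_leP uw; apply/weak_leP => x ux.
have ys : x s = 0 := inv_par uK ux sK; have px := ux.1.
have xs : x <> e s by move=> xs; move/eqP: ys; rewrite xs basisE eqxx oner_eq0.
have l0 : 0 <= lam s x by have := nsum_ge0 s px.2; rewrite /nsum ys mulr0 addr0.
have : inv w (refl s x).
  apply: (inv_comb (refl_pos px xs) ler01 l0 (uw x ux) (elimT (ldescP s w) sw)).
  by rewrite scale1r.
by case/(inv_mulgl_desc _ sw) => [/(refl_neq_basis px) //|]; rewrite reflK.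
Qed.

Lemma cox_below_sink I s w : acyc I -> (s \in I -> sink I s) -> ldesc s w -> wle (cox I) w ->
  wle (cox (I :\ s)) (g s * w)%g.
Proof.
move=> aI sI sw; case: (boolP (s \in I)) => [/sI sI'|nsI Iw].
  by rewrite -(cox_sink_wle aI sI' sw).
have -> : I :\ s = I by apply/setDidPl; rewrite disjoint_sym disjoints1.
exact: wle_mulgl_par (cox_par aI) nsI sw Iw.
Qed.

(** The case of a common acyclic set U. A sink of U occurring in I or K is a left descent of w; by
    [cox_below_sink] it can be cancelled from w even for the one of I and K that does not contain
    it. *)
Lemma cox_union_acyc U I K w : acyc U -> I \subset U -> K \subset U ->
  wle (cox I) w -> wle (cox K) w -> wle (cox (I :|: K)) w.
Proof.
move=> aU; elim/acyc_ind: U / aU I K w => [|U s aU sU IH] I K w IU KU Iw Kw.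
  move: IU KU; rewrite !subset0 => /eqP I0 /eqP K0; move: Iw; by rewrite I0 K0 setU0.
have sinkU (L : {set S}) : L \subset U -> s \in L -> sink L s by move=> LU sL; apply: sinkS sU.
have aS (L : {set S}) : L \subset U -> acyc L by move=> LU; apply: acycS aU.
case: (boolP (s \in I :|: K)) => [sIK|]; last first.
  by rewrite inE => /norP[sI sK]; apply: IH => //; rewrite subsetD1 ?IU ?KU.
have sw : ldesc s w.
  move: sIK; rewrite inE => /orP[sI|sK].
    by apply: ldesc_wle Iw _; apply: cox_sink_ldesc; [exact: aS | exact: sinkU].
  by apply: ldesc_wle Kw _; apply: cox_sink_ldesc; [exact: aS | exact: sinkU].
have IKU : I :|: K \subset U by rewrite subUset IU.
rewrite (cox_sink_wle (aS _ IKU) (sinkU _ IKU sIK) sw).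
rewrite setDUl; apply: IH; try exact: setSD.
  by apply: cox_below_sink => //; [exact: aS | exact: sinkU].
by apply: cox_below_sink => //; [exact: aS | exact: sinkU].
Qed.

Definition source J s := s \in J /\ forall t, t \in J -> ~~ Om t s.

Lemma source_exists J : acyc J -> J != set0 -> exists s, source J s.
Proof.
elim/acyc_ind: J / => [|J s aJ sJ IH J0]; first by rewrite eqxx.
have [Js|/IH[p []]] := eqVneq (J :\ s) set0.
  exists s; split=> [|t tJ]; first exact: sJ.1.
  have [->|ts] := eqVneq t s; first by rewrite (orient_irr s oO).
  by move/setP: Js => /(_ t); rewrite !inE ts tJ.
rewrite !inE => /andP[ps pJ] hp; exists p; split=> // t tJ.
have [->|ts] := eqVneq t s; first by case: sJ => _; apply.
by apply: hp; rewrite !inE ts.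
Qed.

Lemma cox_source J (p : S) : acyc J -> source J p -> cox J = (cox (J :\ p) * g p)%g.
Proof.
have [n] := ubnP #|J|; elim: n J => // n IH J Jn aJ [pJ hp].
have sJp := acycS (subsetDl J [set p]) aJ.
have [Jp|/(sJp _ (subxx _))[s [+ hs]]] := eqVneq (J :\ p) set0.
  have pS : sink J p.
    split=> // t tJ; have [->|tp] := eqVneq t p; first by rewrite (orient_irr p oO).
    by move/setP: Jp => /(_ t); rewrite !inE tp tJ.
  by rewrite (cox_sink aJ pS) Jp cox0 mulg1 mul1g.
rewrite !inE => /andP[sp sJ].
have sS : sink J s.
  split=> // t tJ; have [->|tp] := eqVneq t p; first exact: hp.
  by apply: hs; rewrite !inE tp.
have sSp : sink (J :\ p) s by apply: sinkS sS; rewrite ?subsetDl // !inE sp.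
rewrite (cox_sink aJ sS) (cox_sink sJp sSp) (IH (J :\ s)).
- by rewrite mulgA !setDDl setUC.
- by move: Jn; rewrite (cardsD1 s) sJ.
- exact: acycS (subsetDl _ _) aJ.
- split=> [|t]; first by rewrite !inE eq_sym sp.
  by rewrite !inE => /andP[_ /hp].
Qed.

Lemma cox_source_wle J (p : S) : acyc J -> source J p -> wle (cox (J :\ p)) (cox J).
Proof.
move=> aJ pJ; rewrite /weak_le (cox_source aJ pJ) mulKg -(cox_source aJ pJ) len_gen.
rewrite !len_cox //; last exact: acycS (subsetDl _ _) aJ.
by rewrite (cardsD1 p J) pJ.1 addnC.
Qed.

(** A sink s of M outside K is joined to no vertex of K, since K is closed under outgoing edges. Its
    reflection thus fixes the inversions of c(K). *)
Lemma cox_closed_wle M K : acyc M -> K \subset M ->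
  (forall s t, s \in K -> t \in M -> Om s t -> t \in K) -> wle (cox K) (cox M).
Proof.
move=> aM; elim/acyc_ind: M / aM K => [|M s aM sM IH] K KM cK.
  by move: KM; rewrite subset0 => /eqP ->; exact: wle_refl.
have aK : acyc K := acycS KM aM.
case: (boolP (s \in K)) => [sK|sK].
  have sK' : sink K s := sinkS KM sK sM.
  rewrite (cox_sink aK sK') (cox_sink aM sM) wle_mulgl ?cox_sink_nldesc //.
  apply: IH => [|r t]; first exact: setSD.
  by rewrite !inE => /andP[rs rK] /andP[-> tM] /cK ->.
have KMs : K \subset M :\ s by rewrite subsetD1 KM.
have /weak_leP IHK : wle (cox K) (cox (M :\ s)).
  by apply: IH => // r t rK; rewrite !inE => /andP[_ tM]; apply: cK.
rewrite (cox_sink aM sM); apply/weak_leP => x Kx.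
apply/(inv_mulgl _ (cox_sink_nldesc s aM)); right.
suff -> : refl s x = x by apply: IHK.
have xK := inv_par (cox_par aK) Kx.
suff l0 : lam s x = 0 by rewrite /refl l0 scale0r addr0.
apply: big1 => t _; case: (boolP (t \in K)) => [tK|/xK ->]; last by rewrite mulr0.
have st : s != t by apply: contraNneq sK => ->.
rewrite (orient_coef0 oO st) ?mul0r //; first by case: sM => _; apply; apply: (subsetP KM).
by apply: contra sK => /cK; apply=> //; case: sM.
Qed.

Lemma nsum_ge1 s t x : nonneg x -> t != s -> 1 <= coef s t -> 1 <= x t -> 1 <= nsum s x.
Proof.
move=> x0 ts c1 x1; rewrite nsumE (bigD1 t) //=; apply: ler_wpDr.
  by apply: sumr_ge0 => i /andP[is_ _]; rewrite mulr_ge0 // coef_ge0 // eq_sym.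
by apply: (le_trans x1); rewrite ler_peMl // (le_trans ler01).
Qed.

(* For a representation of the quiver, x is the class of a projective cover. *)
Lemma cox_closed_root J (p : S) : acyc J -> p \in J -> exists x, [/\ inv (cox J) x, 1 <= x p,
  forall s, x s = 0 \/ 1 <= x s &
  forall s t, t \in J -> x s != 0 -> Om s t -> x t != 0].
Proof.
move=> aJ; elim/acyc_ind: J / aJ => [|J s aJ sJ IH pJ]; first by rewrite inE.
have sc := cox_sink_ldesc aJ sJ.
have [->|ps] := eqVneq p s.
  exists (e s); split; first exact/ldescP.
  - by rewrite basisE eqxx.
  - by move=> t; rewrite basisE; case: eqVneq => _; [right | left].
  move=> r t tJ; rewrite basisE; have [->|_] := eqVneq r s; last by rewrite eqxx.
  by move=> _ st; case: sJ => _ /(_ t tJ); rewrite st.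
have [|x [ix x1 x01 xc]] := IH; first by rewrite !inE ps.
have x0 := ix.1.2; have aJs := acycS (subsetDl J [set s]) aJ.
have xs : x s = 0 by apply: inv_par (cox_par aJs) ix _ _; rewrite !inE eqxx.
have ys : refl s x s = nsum s x.
  by rewrite /refl /nsum !vE basisE eqxx xs mulr0 mulr1 addr0 add0r.
exists (refl s x); split.
- by rewrite (cox_sink aJ sJ); apply/(inv_mulgl _ (cox_sink_nldesc s aJ)); rewrite reflK; right.
- by rewrite refl_other.
- move=> t; have [->|ts] := eqVneq t s; last by rewrite refl_other.
  rewrite ys; case: (classic (exists r, [/\ r != s, 1 <= coef s r & 1 <= x r])).
    by move=> [r [rs c1 r1]]; right; apply: nsum_ge1 r1.
  move=> h; left; rewrite nsumE; apply: big1 => r rs.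
  case: (x01 r) => [->|r1]; first by rewrite mulr0.
  have := @coef_ge _ C s r; rewrite eq_sym => /(_ rs)[->|c1]; first by rewrite mul0r.
  by case: h; exists r.
move=> r t tJ; have [->|rs] := eqVneq r s.
  by move=> _ st; case: sJ => _ /(_ t tJ); rewrite st.
rewrite refl_other // => xr rt; have [ts|ts] := eqVneq t s; last first.
  by rewrite refl_other //; apply: xc xr rt; rewrite !inE ts.
rewrite ts ys gt_eqF //; apply: (lt_le_trans ltr01); apply: (nsum_ge1 _ rs) => //.
  by rewrite coefC; apply: orient_coef oO _; rewrite -ts.
by case: (x01 r) xr => // ->; rewrite eqxx.
Qed.

End CoxeterElements.

(** * The unique maximal acyclic set below an element *)

Section MaximalAcyclic.

Variables (W : groupType) (C : coxeterSystem W).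
Local Notation S := (simple_refl C).
Local Notation V := (vect S).
Local Notation g := (@gen W C).
Local Notation e := (@basis S).
Local Notation len := (@cox_length W C).
Local Notation wle := (@weak_le W C).
Local Notation in_par := (@in_par W C).
Variable Om : rel S.
Hypothesis oO : orientation Om.
Local Notation cox := (cox_elt Om).
Local Notation acyc := (acyc Om).
Local Notation sink := (sink Om).
Local Notation source := (source Om).
Implicit Types (s t r : S) (u v w : W) (x y z : V) (I J K M U : {set S}).

Lemma root_reflection x y : is_root x -> is_root y -> is_root (x - bil x y *: y).
Proof. by move=> rx [u [s ->]]; rewrite -act_reflection; apply: root_act. Qed.

(* The reflections in x and y generate an infinite dihedral group, infinitely
   many of whose roots lie in the cone spanned by x and y. *)
Lemma inv_bil_gt w x y : inv w x -> inv w y -> - 2 < bil x y.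
Proof.
move=> ix iy; rewrite ltNge; apply/negP => xy.
set a := - bil x y; have a2 : 2 <= a by rewrite /a; lra.
have bxy : bil x y = - a by rewrite /a opprK.
have byx : bil y x = - a by rewrite bilC.
have bxx := root_bil ix.1.1; have byy := root_bil iy.1.1.
(* [d n] and [d' n] are two families of dihedral roots: the reflection in x sends [d' n] to
   [d n.+1], that in y sends [d n] to [d' n.+1]. *)
pose U := cheb a; pose d n := U n.+1 *: x + U n *: y; pose d' n := U n *: x + U n.+1 *: y.
have U0 n : 0 <= U n by case: (cheb_grow n a2).
have droot n : is_root (d n) /\ is_root (d' n).
  elim: n => [|n [IH IH']].
    rewrite /d /d' /U cheb0 cheb1 !scale0r !scale1r addr0 add0r.
    by split; [exact: ix.1.1 | exact: iy.1.1].
  split.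
    have -> : d n.+1 = d' n - bil (d' n) x *: x.
      apply/ffunP => s; rewrite /d /d' bilDl !bilZl bxx byx /U chebSS !vE; ring.
    exact: root_reflection IH' ix.1.1.
  have -> : d' n.+1 = d n - bil (d n) y *: y.
    apply/ffunP => s; rewrite /d /d' bilDl !bilZl bxy byy /U chebSS !vE; ring.
  exact: root_reflection IH iy.1.1.
have dinv n : inv w (d n).
  apply: (inv_comb _ (U0 n.+1) (U0 n) ix iy) => //; split; first by case: (droot n).
  by apply: nonnegD; apply: nonnegZ; rewrite ?U0 //; [exact: ix.1.2 | exact: iy.1.2].
have [s xs] : exists s, 0 < x s.
  apply: NNPP => h; apply: (root_neq0 ix.1.1); apply/ffunP => s; rewrite v0E.
  apply/le_anti; rewrite ix.1.2 andbT leNgt; apply/negP => xs; apply: h; by exists s.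
have dlt n : d n s < d n.+1 s.
  rewrite /d !vE; have [h1 _] := cheb_grow n a2; have [h2 _] := cheb_grow n.+1 a2.
  rewrite -subr_gt0 (_ : _ - _ = (U n.+2 - U n.+1) * x s + (U n.+1 - U n) * y s); last by ring.
  apply: ltr_wpDr; first by rewrite mulr_ge0 ?iy.1.2 //; rewrite /U; lra.
  by rewrite mulr_gt0 //; rewrite /U; lra.
clearbody d.
have dmono m n : (m < n)%N -> d m s < d n s.
  elim: n => // n IH; rewrite ltnS leq_eqVlt => /orP[/eqP->//|/IH h].
  exact: lt_trans h (dlt n).
have dinj : injective d.
  by move=> m n mn; case: (ltngtP m n) => // /dmono; rewrite mn ltxx.
have [l sl hl] := inv_finite C w.
have : (size (map d (iota 0 (len w).+1)) <= size l)%N.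
  apply: uniq_leq_size; first by rewrite map_inj_uniq // iota_uniq.
  by move=> z /mapP[n _ ->]; apply: hl.
by rewrite size_map size_iota sl ltnn.
Qed.

(** Disjoint supports make every term of -bil x y nonnegative. The edges i - l and p - k contribute
    at least 1 each, and the last hypothesis makes them distinct. *)
Lemma bil_disjoint_le x y i k p l : nonneg x -> nonneg y ->
  (forall s, x s != 0 -> y s = 0) -> 1 <= x i -> 1 <= x p -> 1 <= y k -> 1 <= y l ->
  1 <= coef i l -> 1 <= coef p k -> (i = p -> l <> k) -> bil x y <= - 2.
Proof.
move=> x0 y0 xy xi xp yk yl il pk ne.
have n0 s : 0 <= x s * lam s y.
  have [->|xs] := eqVneq (x s) 0; first by rewrite mul0r.
  by rewrite mulr_ge0 //; have := nsum_ge0 s y0; rewrite /nsum xy // mulr0 addr0.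
have lamE s : 1 <= x s -> nsum s y = lam s y.
  move=> xs; rewrite /nsum xy ?mulr0 ?addr0 // gt_eqF //; exact: lt_le_trans xs.
have ynz s t : 1 <= x s -> 1 <= y t -> t != s.
  move=> xs yt; apply: contraTneq yt => ->; rewrite xy ?ler10 //.
  by rewrite gt_eqF //; exact: lt_le_trans xs.
have lam_ge1 s t : 1 <= x s -> 1 <= y t -> 1 <= coef s t -> 1 <= lam s y.
  by move=> xs yt st; rewrite -lamE //; apply: nsum_ge1 (ynz s t xs yt) st yt.
have mul1 s t : 1 <= x s -> 1 <= y t -> 1 <= coef s t -> 1 <= x s * lam s y.
  by move=> xs yt st; rewrite mulr_ege1 ?(lam_ge1 s t).
rewrite /bil lerN2; have [ip|ip] := eqVneq i p.
  rewrite (bigD1 p) //=; apply: ler_wpDr; first by apply: sumr_ge0.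
  suff h : 2 <= lam p y by apply: (le_trans h); rewrite ler_peMl // (le_trans _ h).
  rewrite -lamE // nsumE (bigD1 k) ?ynz //= (bigD1 l) /=; last first.
    by rewrite ynz //; apply/eqP; exact: ne.
  have h1 : 1 <= coef p k * y k by rewrite mulr_ege1.
  have h2 : 1 <= coef p l * y l by rewrite mulr_ege1 // -ip.
  have : 0 <= \sum_(t | (t != p) && (t != k) && (t != l)) coef p t * y t.
    by apply: sumr_ge0 => t /andP[/andP[tp _] _]; rewrite mulr_ge0 // coef_ge0 // eq_sym.
  lra.
rewrite (bigD1 i) //= (bigD1 p) 1?eq_sym //=.
have := mul1 i l xi yl il; have := mul1 p k xp yk pk.
have : 0 <= \sum_(s | (s != i) && (s != p)) x s * lam s y by apply: sumr_ge0.
lra.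
Qed.

(* If p + M had no sink, the classes of the projective covers of p over I and of
   a suitable l over a closed part of M avoiding the first support would have
   disjoint supports joined by two edges. *)
Lemma acyc_add_source w I M (p : S) : acyc I -> acyc M -> source I p -> p \notin M ->
  I :\ p \subset M -> wle (cox I) w -> wle (cox M) w -> acyc (p |: M).
Proof.
have [n] := ubnP #|M|; elim: n w I M => // n IH w I M Mn aI aM pI pM IM Iw Mw.
have IpM : I \subset p |: M by rewrite -subDset.
case: (classic (exists k, sink (p |: M) k)) => [[k kS]|nsink].
  apply: (acyc_sink kS); have [->|kp] := eqVneq k p; first by rewrite setU1K.
  have kM : k \in M by have := kS.1; rewrite !inE (negPf kp).
  have kM' : sink M k by apply: sinkS kS; rewrite ?subsetUr.
  have kw : ldesc k w by apply: ldesc_wle Mw _; apply: cox_sink_ldesc.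
  have kI : k \in I -> sink I k by move=> kI; apply: sinkS kS.
  have -> : (p |: M) :\ k = p |: (M :\ k).
    by rewrite setDUl; congr (_ :|: _); apply/setDidPl; rewrite disjoints1 inE eq_sym.
  apply: (IH (g k * w)%g (I :\ k) (M :\ k)).
  - by move: Mn; rewrite (cardsD1 k) kM.
  - exact: acycS (subsetDl _ _) aI.
  - exact: acycS (subsetDl _ _) aM.
  - split=> [|t]; first by rewrite !inE eq_sym kp pI.1.
    by rewrite !inE => /andP[_]; exact: pI.2.
  - by rewrite !inE (negPf pM) andbF.
  - by rewrite setDDl setUC -setDDl; apply: setSD.
  - exact: cox_below_sink.
  - exact: cox_below_sink.
have nout k : k \in p |: M -> exists2 t, t \in p |: M & Om k t.
  move=> kM; apply: NNPP => h; apply: nsink; exists k; split=> // t tM.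
  by apply/negP => kt; apply: h; exists t.
have sinkM k : sink M k -> Om k p /\ k \notin I.
  move=> [kM hk]; have [|t] := nout k; first by rewrite !inE kM orbT.
  rewrite !inE => /orP[/eqP->|tM]; last by rewrite (negPf (hk t tM)).
  by move=> kp; split=> //; apply/negP => /pI.2; rewrite kp.
have [b [ib b1 b01 bc]] := cox_closed_root oO aI pI.1.
have bI s : b s != 0 -> s \in I.
  by apply: contraNT => /(inv_par (cox_par oO aI) ib) ->.
have b1' s : b s != 0 -> 1 <= b s by case: (b01 s) => // ->; rewrite eqxx.
have bp : b p != 0 by rewrite gt_eqF //; exact: lt_le_trans b1.
pose eM : rel S := fun s t => [&& s \in M, t \in M & Om s t].
(* G consists of the vertices of M from which the support of b can be reached inside M. Its
   complement in M is closed under outgoing edges and avoids that support. *)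
pose G := [set s in M | [exists t, [&& t \in M, b t != 0 & connect eM s t]]].
have GM : G \subset M by apply/subsetP => s; rewrite inE => /andP[].
have closedG s t : s \in M :\: G -> t \in M -> Om s t -> t \in M :\: G.
  rewrite inE => /andP[sG sM] tM st; rewrite inE tM andbT; apply: contra sG.
  rewrite !inE tM sM => /existsP[r /and3P[rM br tr]]; apply/existsP; exists r.
  by rewrite rM br (connect_trans _ tr) // connect1 //; apply/and3P.
have disj s : b s != 0 -> s \notin M :\: G.
  move=> bs; rewrite !inE negb_and negbK; case: (boolP (s \in M)) => //= sM.
  by rewrite orbF; apply/existsP; exists s; rewrite sM bs connect0.
(* The edge i -> l leaves the support of b. If G is empty it starts at p. Otherwise it starts at a
   sink r of G: r lies in the support of b, hence in I, so its outgoing edge cannot end at the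
   source p and must leave G. *)
have [i [l [bi lM il]]] : exists i l, [/\ b i != 0, l \in M :\: G & Om i l].
  have [G0|/(aM _ GM)[r [rG hr]]] := eqVneq G set0.
    have [|t] := nout p; first by rewrite !inE eqxx.
    rewrite !inE => /orP[/eqP->|tM pt]; first by rewrite (orient_irr p oO).
    by exists p, t; rewrite bp G0 setD0.
  have rM := subsetP GM r rG; have br : b r != 0.
    move: rG; rewrite inE rM => /existsP[t /and3P[tM bt /connectP[[|r' q] /=]]].
      by move=> _ <-.
    case/andP=> /and3P[_ r'M rr'] r'q tE.
    have : r' \in G.
      rewrite inE r'M; apply/existsP; exists t; rewrite tM bt.
      by apply/connectP; exists q.
    by move/hr; rewrite rr'.
  have rI := bI r br; have [|t] := nout r; first by rewrite !inE rM orbT.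
  rewrite !inE => /orP[/eqP->|tM] rt; first by have := pI.2 r rI; rewrite rt.
  exists r, t; split=> //; rewrite inE tM andbT.
  by apply/negP => /hr; rewrite rt.
have aG : acyc (M :\: G) := acycS (subsetDl _ _) aM.
have Gw : wle (cox (M :\: G)) w.
  by apply: wle_trans Mw; apply: cox_closed_wle => //; rewrite ?subsetDl.
have [c [ic c1 c01 cc]] := cox_closed_root oO aG lM.
have cM s : c s != 0 -> s \in M :\: G.
  by apply: contraNT => /(inv_par (cox_par oO aG) ic) ->.
have c1' s : c s != 0 -> 1 <= c s by case: (c01 s) => // ->; rewrite eqxx.
have cl : c l != 0 by rewrite gt_eqF //; exact: lt_le_trans c1.
pose E := [set s | c s != 0].
have EM : E \subset M by apply/subsetP => s; rewrite inE => /cM; rewrite inE => /andP[].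
(* The support of c is closed under outgoing edges in M, so its sink k is a sink of M. As p + M has
   no sink, k -> p is an edge, oriented towards the support of b, unlike i -> l. *)
have [|k [kE hk]] := aM E EM; first by apply/set0Pn; exists l; rewrite inE.
have ck : c k != 0 by rewrite inE in kE.
have [|kp _] := sinkM k.
  split=> [|t tM]; first exact: (subsetP EM).
  apply/negP => kt; have tG := closedG k t (cM k ck) tM kt.
  by have := hk t; rewrite inE kt => /(_ (cc k t tG ck kt)).
have ib' : inv w b by apply: ((weak_leP _ _ _).1 Iw).
have ic' : inv w c by apply: ((weak_leP _ _ _).1 Gw).
suff : bil b c <= - 2 by rewrite leNgt (inv_bil_gt ib' ic').
apply: (@bil_disjoint_le b c i k p l) => //; try exact: b1'; try exact: c1'.
- exact: ib.1.2.
- exact: ic.1.2.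
- by move=> s /disj; apply: contraNeq => /cM.
- exact: orient_coef il.
- by rewrite coefC; exact: orient_coef kp.
move=> ip lk; have := orient_asym oO kp; rewrite -lk -ip il //.
Qed.

(** Removing a source p of I leaves a prefix of c(I), so induction gives M = (I - p) + K below w.
    Once [acyc_add_source] shows that p + M is acyclic, the case of a common acyclic set applies. *)
Lemma cox_union I K w : acyc I -> acyc K -> wle (cox I) w -> wle (cox K) w ->
  acyc (I :|: K) /\ wle (cox (I :|: K)) w.
Proof.
have [n] := ubnP #|I|; elim: n I => // n IH I In aI aK Iw Kw.
have [->|I0] := eqVneq I set0; first by rewrite set0U.
have [p pI] := source_exists oO aI I0.
have aIp : acyc (I :\ p) := acycS (subsetDl _ _) aI.
have [|||||aM Mw] := IH (I :\ p) => //; first by move: In; rewrite (cardsD1 p) pI.1.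
  exact: wle_trans (cox_source_wle oO aI pI) Iw.
have pM : I :|: K = p |: ((I :\ p) :|: K) by rewrite setUA setD1K // pI.1.
case: (boolP (p \in (I :\ p) :|: K)) => [pIK|pIK].
  by rewrite pM (setUidPr _) // sub1set.
have aU : acyc (I :|: K).
  by rewrite pM; apply: (acyc_add_source aI aM pI pIK _ Iw Mw); rewrite subsetUl.
split=> //.
have -> : I :|: K = I :|: ((I :\ p) :|: K) by rewrite setUA (setUidPl (subsetDl _ _)).
apply: (cox_union_acyc oO aU) => //; first by rewrite subsetUl.
by rewrite subUset subsetUr (subset_trans (subsetDl _ _)) // subsetUl.
Qed.

Local Notation maxJ := (maxJ Om).

Lemma maxJP w : [/\ acyc (maxJ w), wle (cox (maxJ w)) w &
  forall I, acyc I -> wle (cox I) w -> I \subset maxJ w].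
Proof.
have belowP I : reflect (acyc I /\ wle (cox I) w) (acyclic_below Om w I).
  by apply: (iffP andP) => -[/acyclicP ? ?]; split=> //; apply/acyclicP.
rewrite /maxJ; case: pickP => [J /maxsetP[/belowP[aJ Jw] Jmax]|h]; last first.
  have [|J Jmax _] := @maxset_exists _ (acyclic_below Om w) set0; last by have := h J; rewrite /= Jmax.
  by apply/belowP; split; [exact: acyc0 | rewrite cox0 //; exact: wle1].
split=> // I aI Iw; have [aU Uw] := cox_union aI aJ Iw Jw.
rewrite /= -[J in X in _ \subset X](Jmax (I :|: J)) ?subsetUl ?subsetUr //.
exact/belowP.
Qed.

End MaximalAcyclic.

(** * Sortable elements are aligned *)

Section Sortable.

Variables (W : groupType) (C : coxeterSystem W).
Local Notation S := (simple_refl C).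
Local Notation g := (@gen W C).
Local Notation len := (@cox_length W C).
Local Notation wle := (@weak_le W C).
Local Notation in_par := (@in_par W C).
Variable Om : rel S.
Hypothesis oO : orientation Om.
Local Notation cox := (cox_elt Om).
Local Notation acyc := (acyc Om).
Local Notation maxJ := (maxJ Om).
Local Notation step := (sort_step Om).
Implicit Types (s t r : S) (u v w : W) (I J K P : {set S}).

Lemma flip_setU1 s K r t : s \notin K ->
  flip [set s] (flip K Om) r t = flip (s |: K) Om r t.
Proof.
move=> sK; rewrite /flip !inE.
have [->|rs] := eqVneq r s; have [->|ts] := eqVneq t s; rewrite ?(negPf sK) //=.
- by case: (t \in K).
- by case: (r \in K).
Qed.

Lemma flip_setD1 s K r t : s \in K ->
  flip [set s] (flip K Om) r t = flip (K :\ s) Om r t.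
Proof.
move=> sK; rewrite /flip !inE.
have [->|rs] := eqVneq r s; have [->|ts] := eqVneq t s; rewrite ?sK //=.
- by case: (t \in K).
- by case: (r \in K).
Qed.

Lemma aligned_eq (Om1 Om2 : rel S) w : (forall s t, Om1 s t = Om2 s t) ->
  aligned Om1 w -> aligned Om2 w.
Proof. by move=> h; apply: (aligned_agree _ (parT C w)) => s t _ _; exact: h. Qed.

Lemma aligned_flip_self K w : in_par K w -> aligned (flip K Om) w <-> aligned Om w.
Proof. by move=> wK; split; apply: (aligned_agree _ wK) => s t sK tK; rewrite /flip sK tK. Qed.

Lemma cox_supp I J : acyc I -> in_par J (cox I) -> I \subset J.
Proof.
move=> aI; elim/(acyc_ind (Om := Om)): I / aI => [|I s aI sI IH cJ]; first by rewrite sub0set.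
have sJ : s \in J := par_ldesc cJ (cox_sink_ldesc oO aI sI).
rewrite -(setD1K sI.1) subUset sub1set sJ /=; apply: IH.
by rewrite -(genK s (cox _)) -(cox_sink oO aI sI); apply: parM cJ; apply: par_gen.
Qed.

(* The letters of J are read in an order compatible with Om. P is the set of
   letters already read and K the set of those that were used; they have become
   sources, which is recorded by the orientation flip K Om. *)
Lemma aligned_pass J w P K v : acyc J -> P \subset J -> K \subset P ->
  (forall s t, s \in P -> t \in J -> Om s t -> t \in P) ->
  w = (cox K * v)%g -> wle (cox K) w -> in_par ((J :\: P) :|: K) v -> aligned (flip K Om) v ->
  exists K' v', [/\ K' \subset J, w = (cox K' * v')%g, wle (cox K') w, in_par K' v' & aligned Om v'].
Proof.
move=> aJ; have [n] := ubnP #|J :\: P|; elim: n P K v => // n IH P K v Pn PJ KP cP wE Kw vJ al.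
have [JP|/(aJ _ (subsetDl _ _))[s sJP]] := eqVneq (J :\: P) set0.
  move: vJ; rewrite JP set0U => vK; exists K, v; split=> //; first exact: subset_trans PJ.
  exact/(aligned_flip_self vK).
have [] := sJP; rewrite inE => /andP[sP sJ] hs.
have sK : s \notin K by apply: contra sP; apply: (subsetP KP).
have aK : acyc K by apply: acycS aJ; apply: subset_trans PJ.
(* Edges between a used letter and s can only point to the used letter, since P is closed under
   outgoing edges in J; reversed, they enter s. *)
have sS : sink (flip K Om) ((J :\: P) :|: K) s.
  split=> [|t]; first by rewrite !inE sP sJ.
  rewrite /flip (negPf sK) inE /=; case: ifP => [tK _|_].
    by apply: contra sP; apply: cP => //; apply: (subsetP KP).
  by rewrite orbF => /hs.
have oK := flip_orientation K oO.
have cP' r t : r \in s |: P -> t \in J -> Om r t -> t \in s |: P.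
  rewrite !inE => /orP[/eqP->|rP] tJ rt; last by rewrite (cP r t) ?orbT.
  case: (boolP (t \in P)) => [_|tP]; first by rewrite orbT.
  by have := hs t; rewrite inE tP tJ rt => /(_ isT).
have P'J : s |: P \subset J by rewrite subUset sub1set sJ.
have P'n : (#|J :\: (s |: P)| < n)%N.
  rewrite setUC -setDDl; move: Pn; rewrite (cardsD1 s) !inE sP sJ; lia.
case: (boolP (ldesc s v)) => [sv|nsv].
  have K'P : s |: K \subset s |: P by rewrite setUS.
  have K'K : (s |: K) :\ s = K by rewrite setU1K.
  have K'src : source Om (s |: K) s.
    split=> [|t]; first by rewrite !inE eqxx.
    rewrite !inE => /orP[/eqP->|tK]; first by rewrite (orient_irr s oO).
    by apply: contra sP; apply: cP => //; apply: (subsetP KP).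
  have aK' : acyc (s |: K) by apply: acycS aJ; apply: subset_trans P'J.
  have cK' : cox (s |: K) = (cox K * g s)%g by rewrite (cox_source oO aK' K'src) K'K.
  have wE' : w = (cox (s |: K) * (g s * v))%g by rewrite cK' -mulgA genK.
  have JE : (J :\: (s |: P)) :|: (s |: K) = (J :\: P) :|: K.
    apply/setP => t; rewrite !inE; have [->|] //= := eqVneq t s; by rewrite sP sJ.
  apply: (IH _ _ _ P'n P'J K'P cP' wE').
  - move: Kw; rewrite /weak_le {1}wE {2}wE' !mulKg !len_cox // cardsU1 sK => /eqP <-.
    by rewrite (len_ldesc sv); apply/eqP; lia.
  - by rewrite JE; apply: parM vJ; apply/par_gen/sS.1.
  - apply: (@aligned_eq (flip [set s] (flip K Om))) => [r t|]; first exact: flip_setU1.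
    exact/(aligned_desc oK sS vJ sv).
have KsP : K \subset s |: P by apply: subset_trans KP _; rewrite subsetUr.
apply: (IH _ _ _ P'n P'J KsP cP' wE) => //.
have := aligned_par oK sS vJ al nsv; congr (in_par _ v).
by apply/setP => t; rewrite !inE; have [->|] //= := eqVneq t s; rewrite (negPf sK).
Qed.

(** The set K read off by [aligned_pass] is J(w): it is contained in J(w) by maximality, and
    conversely w lies in W_K, hence so does c(J(w)) <= w. *)
Lemma aligned_step J w : acyc J -> in_par J w -> aligned Om w ->
  [/\ maxJ w \subset J, in_par (maxJ w) (step w) & aligned Om (step w)].
Proof.
move=> aJ wJ al; have [aM Mw Mmax] := maxJP oO w.
have MJ : maxJ w \subset J by apply: cox_supp aM _; apply: par_le wJ.
have [|||||||K [v [KJ wE Kw vK vE]]] := @aligned_pass J w set0 set0 w aJ; rewrite ?sub0set //.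
- by move=> s t; rewrite inE.
- by rewrite cox0 // mul1g.
- by rewrite cox0 //; exact: wle1.
- by rewrite setD0 setU0.
- by apply: aligned_eq al => s t; rewrite /flip !inE.
have aK : acyc K := acycS KJ aJ.
have KM : K = maxJ w.
  apply/eqP; rewrite eqEsubset Mmax //=; apply: cox_supp aM _; apply: par_le Mw _.
  by rewrite wE; apply: parM vK; apply: cox_par.
have stepE : step w = v by rewrite /sort_step -KM wE mulKg.
by rewrite stepE -KM.
Qed.

Lemma aligned_sortable J w : acyc J -> in_par J w -> aligned Om w -> sortable Om w.
Proof.
move=> aJ wJ al i; elim: i J w aJ wJ al => [|i IH] J w aJ wJ al.
all: have [MJ sM sal] := aligned_step aJ wJ al; have [aM _ _] := maxJP oO w.
  by have [] := aligned_step aM sM sal.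
by rewrite !(iterSr _ _ w); apply: IH aM sM sal.
Qed.

(** The letters of c(K) are put back from the last to the first. Closure of K under incoming edges
    makes the first letter s a sink of J for [flip K Om], as [aligned_desc] requires. *)
Lemma aligned_pass_back J K v : in_par J v -> aligned Om v -> acyc J -> K \subset J ->
  (forall s t, s \in K -> t \in J -> Om t s -> t \in K) ->
  len (cox K * v)%g = (#|K| + len v)%N -> aligned (flip K Om) (cox K * v)%g.
Proof.
move=> vJ al aJ KJ; have aK : acyc K := acycS KJ aJ.
elim/(acyc_ind (Om := Om)): K / aK KJ => [_ _ _|K s aK sK IH KJ cK lK].
  by rewrite (cox0 oO) mul1g; apply: aligned_eq al => s t; rewrite /flip !inE.
have cE := cox_sink oO aK sK; have cardK : #|K| = (#|K :\ s|).+1 by rewrite (cardsD1 s) sK.1.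
have l1 := lenM C (cox (K :\ s)) v; rewrite len_cox // in l1; last exact: acycS (subsetDl _ _) aK.
have ls := len_gen_mulg s (cox (K :\ s) * v)%g; rewrite mulgA -cE in ls.
have KsJ : K :\ s \subset J by apply: subset_trans KJ; apply: subsetDl.
have nsv : ~~ ldesc s (cox (K :\ s) * v)%g.
  by rewrite /ldesc mulgA -cE; case: ls => h; len_lia.
have aKs : acyc (K :\ s) := acycS KsJ aJ.
have {}IH : aligned (flip (K :\ s) Om) (cox (K :\ s) * v)%g.
  apply: IH => // [r t|]; last by case: ls => h; len_lia.
  rewrite !inE => /andP[rs rK] tJ tr; rewrite (cK r t) // andbT.
  by apply: contraTneq tr => ->; case: sK => _; apply.
have sJ : s \in J := subsetP KJ s sK.1.
have sS : sink (flip K Om) J s.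
  split=> // t tJ; rewrite /flip sK.1 /=; case: (boolP (t \in K)) => [tK|tK] /=.
    by case: sK => _; apply.
  by apply: contra tK; apply: cK => //; exact: sK.1.
have oK := flip_orientation K oO.
have kvJ : in_par J (cox K * v)%g by apply: parM => //; apply: parS KJ _; apply: cox_par.
apply/(aligned_desc oK sS kvJ); first by rewrite cE -mulgA ldesc_mul.
rewrite cE -mulgA genK; apply: aligned_eq IH => r t.
by rewrite flip_setD1 //; exact: sK.1.
Qed.

(** For w not 1 the set J_1 contains every left descent, so w_2 is shorter, and it is again
    sortable. The inclusion of J_2 in J_1 places it in W_{J_1}, where the letters of c(J_1) can be
    put back. *)
Lemma sortable_aligned w : sortable Om w -> in_par (maxJ w) w /\ aligned Om w.
Proof.
have [n] := ubnP (len w); elim: n w => // n IH w wn sw.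
have [->|/(exists_ldesc C)[s sdw]] := eqVneq w 1%g; first by split; [exact: par1 | exact: aligned1].
have [aM Mw Mmax] := maxJP oO w.
have wE : w = (cox (maxJ w) * step w)%g by rewrite mulVKg.
have lw : len w = (#|maxJ w| + len (step w))%N.
  by rewrite -(len_cox oO aM); apply/esym/eqP.
have sM : s \in maxJ w.
  have sS : sink Om [set s] s.
    by split=> [|t]; rewrite inE // => /eqP->; rewrite (orient_irr s oO).
  have ss0 : [set s] :\ s = set0 by apply/setP => t; rewrite !inE andNb.
  have as_ : acyc [set s] by apply: (acyc_sink sS); rewrite ss0; exact: acyc0.
  rewrite -sub1set; apply: Mmax => //.
  by rewrite (cox_sink oO as_ sS) ss0 cox0 // mulg1 wle_gen.
have M0 : (0 < #|maxJ w|)%N by rewrite (cardsD1 s) sM.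
have [||vM val] := IH (step w); first by len_lia.
  by move=> i; have := sw i.+1; rewrite !(iterSr _ _ w).
have {}vM : in_par (maxJ w) (step w) by apply: parS vM; exact: (sw 0%N).
have wM : in_par (maxJ w) w by rewrite {2}wE; apply: parM vM; apply: cox_par.
split=> //; apply/(aligned_flip_self wM); rewrite {2}wE.
by apply: aligned_pass_back vM val aM (subxx _) _ _ => //; rewrite -wE.
Qed.

End Sortable.

(** * Meets and joins of sortable elements *)

Theorem theorem1p5 (W : groupType) (C : coxeterSystem W)
    (Om : rel (simple_refl C)) (HOm : orientation Om) (A : W -> Prop)
    (HA : forall a, A a -> sortable Om a) :
  ((exists a, A a) -> exists2 m, is_meet C A m & sortable Om m) /\
  (forall j, is_join C A j -> sortable Om j).
Proof.
split=> [Aex|j jA].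
  have [m mA] := meet_exists C Aex; exists m => //; have [a Aa] := Aex.
  have [aJ _ _] := maxJP HOm a; have [aM _] := sortable_aligned HOm (HA a Aa).
  have mM := par_le (mA.1 a Aa) aM.
  apply: (aligned_sortable HOm aJ mM).
  (* Projecting A to W_{J(a)} keeps the meet, which already lies there, and puts all elements into
     one acyclic parabolic subgroup. *)
  pose B u := exists b, A b /\ forall x, inv u x <-> inv b x /\ supported (maxJ Om a) x.
  apply: (@meet_aligned _ _ Om (maxJ Om a) B) => //.
  - by have [u _ hu] := par_proj (maxJ Om a) a; exists u, a.
  - by move=> u [b [_ h]]; apply/in_parP => x /h[].
  - by move=> u [b [/HA/(sortable_aligned HOm)[_ al] h]]; apply: aligned_proj h al.
  split=> [u [b [Ab h]]|u Bu].
    apply/weak_leP => x mx; apply/h; split; last exact: inv_par mx.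
    exact: ((weak_leP _ _ _).1 (mA.1 b Ab)).
  apply: mA.2 => b Ab; have [v _ vinv] := par_proj (maxJ Om a) b.
  apply: (@wle_trans _ _ _ v); first by apply: Bu; exists b.
  by apply/weak_leP => x /vinv[].
have [aU Uj Umax] := maxJP HOm j.
have AU a : A a -> in_par (maxJ Om j) a.
  move=> Aa; have [aJ Ja _] := maxJP HOm a; have [aM _] := sortable_aligned HOm (HA a Aa).
  by apply: parS aM; apply: Umax => //; apply: wle_trans Ja _; apply: jA.1.
have jmin := is_join_min_upper jA.
apply: (aligned_sortable HOm aU (min_upper_par AU jmin)).
apply: (min_upper_aligned HOm aU AU _ jmin) => a /HA /(sortable_aligned HOm)[] //.
Qed.
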